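(* Let $P\in\mathcal{P}(\mathbb{R}^d)$ have Lebesgue density $p$, and let the kernel $K$, the bandwidth $h=h_N$ and $p$ satisfy the conditions (i)--(iii) listed in the context. Suppose that $Z_1,\dots,Z_N$ are either i.i.d. samples from $P$, or generated by a stationary Markov chain $(Z_k)_{k\in\mathbb{N}}$ in $\mathbb{R}^d$ with invariant distribution $P$ and a spectral gap $\gamma>0$ or a pseudo spectral gap $\gamma_{\mathrm{ps}}>0$. Let $$\hat q_N=\frac1N\sum_{k=1}^N K_h(Z_k,\cdot),\qquad K_h(x,y)=\frac1{h^d}K\Bigl(\frac{x-y}{h}\Bigr).$$ Then there exists a constant $C_{\mathrm{mc}}>0$ (not depending on $N$ or $h$) such that $$\int_{\mathbb{R}^d}\mathbb{E}\Bigl[\bigl(\hat q_N(x)-\mathbb{E}_P[K_h(x,\cdot)]\bigr)^2\Bigr]\mathrm{d}x\le\frac{C_{\mathrm{mc}}}{Nh^d}\|K\|_{L^2(\mathbb{R}^d)}^2=\mathcal{O}\Bigl(\frac1{Nh_N^d}\Bigr).$$ Moreover, if $$M_{K,m}:=\int_{\mathbb{R}^d}(1+\|u\|)^mK(u)^2\,\mathrm{d}u<\infty,\qquad p(x)\le C_p(1+\|x\|)^{-m},\quad x\in\mathbb{R}^d,$$ for certain constants $C_p>0$ and $m>2d$, then $C_1:=\sqrt{C_{\mathrm{mc}}C_pM_{K,m}}\int_{\mathbb{R}^d}(1+\|x\|)^{-m/2}\,\mathrm{d}x<\infty$ and, for $0<h<1$, $$\int_{\mathbb{R}^d}\mathbb{E}\Bigl[\bigl|\hat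 q_N(x)-\mathbb{E}_P[K_h(x,\cdot)]\bigr|\Bigr]\mathrm{d}x\le\frac{C_1}{\sqrt N\,h^{d/2}}=\mathcal{O}\Bigl(\frac1{\sqrt N\,h_N^{d/2}}\Bigr).$$
   Context: Conditions on kernel, bandwidth and density: (i) $K:\mathbb{R}^d\to[0,\infty)$, $K\in L^1(\mathbb{R}^d)\cap L^2(\mathbb{R}^d)$, $\int K(u)\,\mathrm{d}u=1$, $\int uK(u)\,\mathrm{d}u=0$, $\int\|u\|^2|K(u)|\,\mathrm{d}u<\infty$. (ii) $h=h_N>0$ is a scalar bandwidth depending on $N$ with $h_N\to0$ and $Nh_N^d\to\infty$ as $N\to\infty$. (iii) $p\in W^{2,1}(\mathbb{R}^d)\cap W^{2,2}(\mathbb{R}^d)$, i.e. $p$ and its weak derivatives up to order 2 are integrable and square-integrable. Standing assumption: $p$ is strictly positive. Notation: $\mathbb{E}_P[K_h(x,\cdot)]=\int K_h(x,y)\,P(\mathrm{d}y)$. Spectral gaps (standard notions). For a time-homogeneous Markov chain with transition kernel $T$ and invariant distribution $P$, view $T$ as an operator on $L^2(P)$, with adjoint $T^*$. If the chain is reversible, its spectral gap is $\gamma=\gamma(T)=1-\sup\{\lambda:\lambda\in\operatorname{spec}(T),\lambda\ne1\}$ if the eigenvalue $1$ has multiplicity $1$, and $\gamma=0$ otherwise. For a general (possibly non-reversible) chain the pseudo spectral gap is $\gamma_{\mathrm{ps}}=\sup_{k\ge1}\gamma\bigl((T^* )^kT^k\bigr)/k$. A stationary chain is one with $Z_1\sim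 P$.
   Formalization: The centring E_P[K_h(x,·)] = ∫K_h(x,y)P(dy) is replaced by ∫K_h(y,x)P(dy), the mean of q̂_N(x); the two agree for even K, and for non-even K the literal claim fails (squared bias of order h^6 when the third moment is non-zero). *)

(* Defs.v *)
From HB Require Import structures.
From mathcomp Require Import all_boot all_order all_algebra.
From mathcomp Require Import finmap.
From mathcomp Require Import all_classical all_reals all_analysis.

Set Implicit Arguments.
Unset Strict Implicit.
Unset Printing Implicit Defensive.

Import Order.TTheory GRing.Theory Num.Theory.
Import numFieldNormedType.Exports.

Local Open Scope classical_set_scope.
Local Open Scope ring_scope.

(* R^d is 'rV[R]_d.  Its Borel sigma-algebra is the product sigma-algebra, that
   is, the one generated by the d coordinates. *)
Definition rV_display : measure_display. Proof. exact. Qed.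

Section measurable_rV.
Context {R : realType} {d : nat}.

Definition rV_coord (i : 'I_d) (v : 'rV[R]_d) : measurableTypeR R := v 0 i.

Let rV_set0 : g_sigma_preimage rV_coord set0.
Proof. exact: sigma_algebra0. Qed.

Let rV_setC A : g_sigma_preimage rV_coord A -> g_sigma_preimage rV_coord (~` A).
Proof. exact: sigma_algebraC. Qed.

Let rV_bigcup (F : (set 'rV[R]_d)^nat) :
  (forall i, g_sigma_preimage rV_coord (F i)) ->
  g_sigma_preimage rV_coord (\bigcup_i (F i)).
Proof. exact: sigma_algebra_bigcup. Qed.

HB.instance Definition _ := @isMeasurable.Build rV_display
  'rV[R]_d (g_sigma_preimage rV_coord) rV_set0 rV_setC rV_bigcup.

Lemma measurable_rV_coord (i : 'I_d) :
  measurable_fun [set: 'rV[R]_d] (fun v => v 0 i).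
Proof.
move=> _ Y mY; rewrite setTI; apply: sub_sigma_algebra => /=.
rewrite -bigcup_seq/=; exists i => /=; first by rewrite mem_index_enum.
by exists Y => //; rewrite setTI.
Qed.

Lemma measurable_fun_rVP d' (T : measurableType d') (f : T -> 'rV[R]_d) :
  measurable_fun [set: T] f <->
  forall i, measurable_fun [set: T] (fun t => f t 0 i).
Proof.
split=> [mf i|mf].
  exact: (measurableT_comp (measurable_rV_coord i) mf).
apply: (@measurability _ _ _ _ setT f
  (\big[setU/set0]_(i < d) preimage_set_system setT (rV_coord i) measurable)) => //.
move=> _ [B + <-]; rewrite -bigcup_seq => -[i _ [A mA <-]].
rewrite !setTI -comp_preimage.
by have := mf i measurableT A mA; rewrite setTI.
Qed.

End measurable_rV.

Section lebesgue_rV.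
Context {R : realType}.

Definition cons_rV d (u : measurableTypeR R * 'rV[R]_d) : 'rV[R]_d.+1 :=
  \row_i (if unlift ord0 i is Some j then u.2 0 j else u.1).

Definition uncons_rV d (v : 'rV[R]_d.+1) : measurableTypeR R * 'rV[R]_d :=
  (v 0 ord0, \row_j v 0 (lift ord0 j)).

Lemma cons_rVK d : cancel (@cons_rV d) (@uncons_rV d).
Proof.
move=> [x w]; rewrite /uncons_rV mxE unlift_none; congr (_, _).
by apply/rowP => j; rewrite !mxE liftK.
Qed.

Lemma measurable_cons_rV d : measurable_fun setT (@cons_rV d).
Proof.
apply/measurable_fun_rVP => i.
under eq_fun do rewrite mxE.
case: (unlift ord0 i) => [j|]; last exact: measurable_fst.
exact: (measurableT_comp (measurable_rV_coord j) measurable_snd).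
Qed.

Lemma measurable_uncons_rV d : measurable_fun setT (@uncons_rV d).
Proof.
apply/measurable_fun_pairP; split; first exact: measurable_rV_coord.
apply/measurable_fun_rVP => i /=.
under eq_fun do rewrite mxE.
exact: measurable_rV_coord.
Qed.

HB.instance Definition _ d :=
  isMeasurableFun.Build _ _ _ _ (@cons_rV d) (@measurable_cons_rV d).

Section step.
Context {d : nat} (mu : {sigma_finite_measure set 'rV[R]_d -> \bar R}).

Definition lebesgue_rV_step : set 'rV[R]_d.+1 -> \bar R :=
  pushforward (lebesgue_measure \x mu)%E (@cons_rV d).

Let step0 : lebesgue_rV_step set0 = 0%E.
Proof. exact: measure0. Qed.

Let step_ge0 A : (0 <= lebesgue_rV_step A)%E.
Proof. exact: measure_ge0. Qed.

Let step_sigma_additive : semi_sigma_additive lebesgue_rV_step.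
Proof. exact: measure_semi_sigma_additive. Qed.

HB.instance Definition _ := isMeasure.Build _ _ _ lebesgue_rV_step
  step0 step_ge0 step_sigma_additive.

Let step_sigma_finite : sigma_finite setT lebesgue_rV_step.
Proof.
have /sigma_finiteP[F [TF ndF Foo]] := sigma_finiteT (@lebesgue_measure R).
have /sigma_finiteP[G [TG ndG Goo]] := sigma_finiteT mu.
exists (fun n => @uncons_rV d @^-1` (F n `*` G n)).
  apply/esym; rewrite -subTset => v _.
  have [n _ Fn] : (\bigcup_i F i) (v 0 ord0) by rewrite -TF.
  have [k _ Gk] : (\bigcup_i G i) (uncons_rV v).2 by rewrite -TG.
  exists (maxn n k) => //; split => /=.
    by move: Fn; apply/subsetPset/ndF; rewrite leq_maxl.
  by move: Gk; apply/subsetPset/ndG; rewrite leq_maxr.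
move=> k; have [mF Fk] := Foo k; have [mG Gk] := Goo k; split.
  rewrite -[X in measurable X]setTI.
  by apply: measurable_uncons_rV => //; exact: measurableX.
rewrite /lebesgue_rV_step /pushforward -comp_preimage.
rewrite (_ : _ \o _ = id) ?preimage_id; last exact/funext/cons_rVK.
by rewrite product_measure1E// lte_mul_pinfty// ge0_fin_numE.
Qed.

HB.instance Definition _ := Measure_isSigmaFinite.Build _ _ _
  lebesgue_rV_step step_sigma_finite.

End step.

(* Lebesgue measure on R^d, as the d-fold product of the one on R. *)
Fixpoint lebesgue_rV (d : nat) : {sigma_finite_measure set 'rV[R]_d -> \bar R} :=
  if d is d'.+1 then lebesgue_rV_step (lebesgue_rV d') else dirac (0 : 'rV[R]_0).

Lemma lebesgue_rV_box d (A : 'I_d -> set (measurableTypeR R)) :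
  (forall i, measurable (A i)) ->
  lebesgue_rV d [set v | forall i, A i (v 0 i)] =
  (\prod_(i < d) lebesgue_measure (A i))%E.
Proof.
elim: d A => [|d IH] A mA.
  by rewrite big_ord0 /= diracE mem_set//= => -[].
rewrite big_ord_recl [LHS]/= /lebesgue_rV_step /pushforward.
rewrite -(IH (fun i => A (lift ord0 i)))//.
rewrite -product_measure1E//; last first.
  rewrite (_ : mkset _ = \bigcap_(i in [set: 'I_d])
      (fun v => v 0 i) @^-1` A (lift ord0 i)); last first.
    by apply/seteqP; split=> [v Av i _|v Av i]; [exact: Av|exact: (Av i)].
  apply: fin_bigcap_measurable => // i _.
  have := @measurable_rV_coord R d i measurableT _ (mA (lift ord0 i)).
  by rewrite setTI.
congr ((_ \x _)%E _); apply/seteqP; split=> -[x w] /=.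
  move=> Axw; split.
    by have := Axw ord0; rewrite mxE unlift_none.
  by move=> i; have := Axw (lift ord0 i); rewrite mxE liftK.
move=> [Ax Aw] i; rewrite mxE.
by case: unliftP => [j ->|->//]; exact: Aw.
Qed.

End lebesgue_rV.

Section sobolev.
Context {R : realType} {d : nat}.
Local Notation V := 'rV[R]_d.
Local Notation leb := (@lebesgue_rV R d).

(* The library norm on 'rV[R]_d is the sup norm, hence the Euclidean one here. *)
Definition enorm (x : V) : R := Num.sqrt (\sum_i x 0 i ^+ 2).

Definition partial (i : 'I_d) (f : V -> R) (x : V) : R :=
  'D_(delta_mx 0 i : V) f x.

(* A multi-index of order k is encoded by a sequence of k directions. *)
Definition iter_partial (s : seq 'I_d) (f : V -> R) : V -> R :=
  foldr partial f s.

Definition smooth (f : V -> R) :=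
  forall (s : seq 'I_d) (x : V), differentiable (iter_partial s f) x.

Definition test_function (f : V -> R) :=
  smooth f /\ compact (closure [set x | f x != 0]).

Definition weak_derivative (s : seq 'I_d) (f g : V -> R) :=
  forall phi, test_function phi ->
    \int[leb]_x (f x * iter_partial s phi x) =
    (-1) ^+ size s * \int[leb]_x (g x * phi x).

Definition sobolev (k : nat) (q : \bar R) (f : V -> R) :=
  f \in Lfun leb q /\
  forall s : seq 'I_d, (size s <= k)%N ->
    exists2 g, g \in Lfun leb q & weak_derivative s f g.

End sobolev.

Section kernel_estimator.
Context {R : realType} {d : nat}.
Local Notation V := 'rV[R]_d.
Local Notation leb := (@lebesgue_rV R d).

Definition smoothing_kernel (K : V -> R) :=
  [/\ forall u, 0 <= K u,
      K \in Lfun leb 1%E /\ K \in Lfun leb 2%:E,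
      (\int[leb]_u (K u)%:E = 1)%E,
      forall i : 'I_d, (\int[leb]_u (u 0 i * K u)%:E = 0)%E &
      (\int[leb]_u (enorm u ^+ 2 * `|K u|)%:E < +oo)%E].

Definition bandwidth (h : R^nat) :=
  [/\ forall N, (0 < N)%N -> 0 < h N,
      h @ \oo --> 0 &
      (fun N => N%:R * h N ^+ d) @ \oo --> +oo].

Definition has_density (P : probability V R) (p : V -> R) :=
  forall A : set V, measurable A -> P A = (\int[leb]_(x in A) (p x)%:E)%E.

Definition scaled_kernel (K : V -> R) (h : R) (x y : V) : R :=
  (h ^+ d)^-1 * K (h^-1 *: (x - y)).

(* K is not assumed to be even, so the order of the two arguments matters: the
   samples are the first argument both here and in kernel_mean, which makes
   kernel_mean the expectation of kernel_estimate. *)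
Definition kernel_estimate (K : V -> R) (h : R) (N : nat) (z : nat -> V)
    (x : V) : R :=
  N%:R^-1 * \sum_(k < N) scaled_kernel K h (z k) x.

Definition kernel_mean (K : V -> R) (h : R) (P : probability V R) (x : V) : R :=
  \int[P]_y scaled_kernel K h y x.

Lemma kernel_mean_even K h P x : (forall u, K (- u) = K u) ->
  kernel_mean K h P x = \int[P]_y scaled_kernel K h x y.
Proof.
move=> Keven; apply: eq_Rintegral => y _.
by rewrite /scaled_kernel -[in LHS]opprB scalerN Keven.
Qed.

End kernel_estimator.
Arguments bandwidth {R} d h.

Section spectral_gap.
Context {R : realType} d {X : measurableType d} (P : probability X R).
Implicit Types (A B : (X -> R) -> X -> R) (f g : X -> R).

(* An operator on L^2(P) is given by its action on square-integrable functions;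
   equalities of elements of L^2(P) are P-almost everywhere equalities. *)
Local Notation L2 := (Lfun P 2%:E).
Local Notation norm2 f := ('N[P]_2%:E[EFin \o f]%E).

Definition inner f g : R := \int[P]_x (f x * g x).

(* A - l is a bijection of L^2(P) with bounded inverse. *)
Definition resolvent A : set R := [set l |
  (exists c : R, forall f, f \in L2 ->
     (norm2 f <= c%:E * norm2 (fun x => A f x - l * f x)%R)%E) /\
  (forall g, g \in L2 ->
     exists2 f, f \in L2 & (fun x => A f x - l * f x) = g %[ae P])].

Definition spectrum A : set R := ~` resolvent A.

Definition eigenvalue1_simple A :=
  exists e, [/\ e \in L2, ~ (e = cst 0 %[ae P]), A e = e %[ae P] &
    forall f, f \in L2 -> A f = f %[ae P] ->
      exists c : R, f = (fun x => c * e x) %[ae P]].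

(* Used for self-adjoint A only: their spectrum is real, so that working with
   the real space L^2(P) loses nothing. *)
Definition spectral_gap A : R :=
  if `[< eigenvalue1_simple A >]
  then 1 - sup (spectrum A `\ 1) else 0.

Definition is_adjoint A B :=
  (forall g, g \in L2 -> B g \in L2) /\
  (forall f g, f \in L2 -> g \in L2 -> inner (A f) g = inner f (B g)).

(* B is meant to be the adjoint of A, which is unique up to P-null sets. *)
Definition pseudo_spectral_gap A B : R :=
  sup [set r | exists2 k : nat, (0 < k)%N &
    r = spectral_gap (fun f => iter k B (iter k A f)) / k%:R].

End spectral_gap.

Section samples.
Context {R : realType} dX {X : measurableType dX} dO {Omega : measurableType dO}.
Variables (Pr : probability Omega R) (P : probability X R).

(* Indices are shifted by one: Z k stands for Z_{k+1}, so the initial state of a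
   chain is Z 0 and a sample of size N is Z 0, ..., Z (N - 1). *)
Definition identically_distributed (Z : nat -> {RV Pr >-> X}) :=
  forall k (A : set X), measurable A -> Pr (Z k @^-1` A) = P A.

Definition mutually_independent (Z : nat -> {RV Pr >-> X}) :=
  forall (J : {fset nat}) (A : nat -> set X), (forall k, measurable (A k)) ->
    Pr (\bigcap_(k in [set` J]) (Z k @^-1` A k)) =
    (\prod_(k <- J) Pr (Z k @^-1` A k))%E.

Definition iid (Z : nat -> {RV Pr >-> X}) :=
  identically_distributed Z /\ mutually_independent Z.

Definition invariant_distribution (T : R.-pker X ~> X) :=
  forall A : set X, measurable A -> (\int[P]_x T x A = P A)%E.

Definition reversible (T : R.-pker X ~> X) :=
  forall A B : set X, measurable A -> measurable B ->
    (\int[P]_(x in A) T x B = \int[P]_(x in B) T x A)%E.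

(* Pr[Z_{n+1} in B | Z_0, ..., Z_n] = T(Z_n, B) almost surely. *)
Definition markov_chain (T : R.-pker X ~> X) (Z : nat -> {RV Pr >-> X}) :=
  forall n (F : set Omega) (B : set X),
    g_sigma_preimage (fun (i : 'I_n.+1) => Z i : Omega -> X) F ->
    measurable B ->
    Pr (F `&` Z n.+1 @^-1` B) = (\int[Pr]_(w in F) T (Z n w) B)%E.

Definition stationary_markov_chain (T : R.-pker X ~> X)
    (Z : nat -> {RV Pr >-> X}) :=
  [/\ invariant_distribution T, markov_chain T Z &
      forall A : set X, measurable A -> Pr (Z 0 @^-1` A) = P A].

Definition transition_operator (T : R.-pker X ~> X) (f : X -> R) (x : X) : R :=
  \int[T x]_y f y.

Definition has_spectral_gap (T : R.-pker X ~> X) :=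
  reversible T /\ 0 < spectral_gap P (transition_operator T).

Definition has_pseudo_spectral_gap (T : R.-pker X ~> X) :=
  exists2 B, is_adjoint P (transition_operator T) B &
    0 < pseudo_spectral_gap P (transition_operator T) B.

End samples.

Section errors.
Context {R : realType} {d : nat} dO {Omega : measurableType dO}.
Variables (Pr : probability Omega R).
Local Notation V := 'rV[R]_d.
Variables (P : probability V R) (K : V -> R) (Z : nat -> {RV Pr >-> V}).

Definition estimation_error (h : R) (N : nat) (x : V) (w : Omega) : R :=
  kernel_estimate K h N (fun k => Z k w) x - kernel_mean K h P x.

Definition L2_error (h : R) (N : nat) : \bar R :=
  (\int[@lebesgue_rV R d]_x
     'E_Pr[(fun w => (estimation_error h N x w) ^+ 2)%R])%E.

Definition L1_error (h : R) (N : nat) : \bar R :=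
  (\int[@lebesgue_rV R d]_x
     'E_Pr[(fun w => `|estimation_error h N x w|)%R])%E.

End errors.

(* Main.v *)
Require Import Defs.
From mathcomp Require Import all_boot all_order all_algebra.
From mathcomp Require Import finmap.
From mathcomp Require Import all_classical all_reals all_analysis.
From mathcomp Require Import measurable_realfun ring lra.

Set Implicit Arguments.
Unset Strict Implicit.
Unset Printing Implicit Defensive.

Import Order.TTheory GRing.Theory Num.Theory.
Import numFieldNormedType.Exports.

Local Open Scope classical_set_scope.
Local Open Scope ring_scope.

(* For f in L2(P) of mean zero, the variance of the sum of f (Z_k) over k < N is
   controlled by the correlations <f, T^j f>. Everything rests on an estimate
   |w| <= c |w - T w| on the orthogonal of the constants: applied to
   s_n = f + T f + ... + T^(n-1) f, for which s_n - T s_n = f - T^n f, it bounds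
   s_n by 2 c |f| uniformly in n, so that the variance is O(N |f|^2). The i.i.d.
   case is T w = E w.

   The estimate follows from a spectral gap g of a symmetric contraction A
   (A = T, or A = (T^* )^k T^k) without the spectral theorem. If no point of
   ]1 - g, 1[ is in the spectrum, then <(A - 1) f, (A - l) f> >= 0 for l = 1 - g,
   since (A - c)^2 has no spectrum below (g / 2)^2 for c = 1 - g / 2. Hence
   g <S f, f> <= |S f|^2 for S = 1 - A, and by Cauchy-Schwarz for the form
   <S _, _>, g |w|^2 <= <S w, w> for w in the range of S. The ergodic averages
   of f differ from f by elements of the range of S; along powers of 2 they form
   a Cauchy sequence, whose limit is fixed by A and orthogonal to the constants,
   hence is 0 as the eigenvalue 1 is simple.

   With f := K_h (_, x), integrating in x gives the first bound. For the second,
   E|err| is bounded by the square root of E(err^2), and the change of variables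
   y = x + h u together with 1 + |x| <= (1 + |x + h u|) (1 + |u|) yields an
   integrable majorant in x. *)

(** * Semi-inner products and contractions *)

(** Letting [n] tend to infinity removes the geometric error. Limits in the abstract space are taken
    through this statement, so that [V] needs no topology. *)
Lemma le_of_le_geometric (R : realType) (x y D q : R) : 0 <= q < 1 ->
  (forall n, x <= y + D * q ^+ n) -> x <= y.
Proof.
move=> /andP[q0 q1] H.
have q1' : `|q| < 1 by rewrite ger0_norm.
have cv : (fun n => y + D * q ^+ n) @ \oo --> y.
  rewrite -[X in _ --> X]addr0; apply: cvgD; first exact: cvg_cst.
  rewrite -[X in _ --> X](mulr0 D); apply: cvgM; first exact: cvg_cst.
  exact: cvg_expr.
rewrite -(cvg_lim (@Rhausdorff R) cv); apply: limr_ge.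
  by apply/cvg_ex; exists y.
by near=> n; exact: H.
Unshelve. all: by end_near.
Qed.

Section semi_inner_product.
Variables (R : realType) (V : lmodType R).
Implicit Types (ip : V -> V -> R) (f g h u v w : V) (A : V -> V).

(** Definiteness is left out on purpose: vectors of norm 0 stand for functions that vanish almost
    everywhere, which allows working with functions instead of their classes. *)
Record semi_inner_product ip : Prop := SemiInnerProduct {
  sipC : forall f g, ip f g = ip g f ;
  sipDl : forall f g h, ip (f + g) h = ip f h + ip g h ;
  sipZl : forall a f h, ip (a *: f) h = a * ip f h ;
  sip_ge0 : forall f, 0 <= ip f f }.

Definition sip_norm ip v := Num.sqrt (ip v v).

(** Completeness for sequences with geometric increments, with an explicit rate; the limit is
    determined up to a null vector only. *)
Definition geometrically_complete ip := forall (q C : R) (u : nat -> V),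
  0 <= q < 1 -> (forall n, sip_norm ip (u n.+1 - u n) <= C * q ^+ n) ->
  exists v, forall n, sip_norm ip (u n - v) <= C / (1 - q) * q ^+ n.

(* Linear up to null vectors. *)
Definition weakly_linear ip A := forall a f g h,
  ip (A (a *: f + g)) h = a * ip (A f) h + ip (A g) h.

Definition symmetric_for ip A := forall f g, ip (A f) g = ip f (A g).

Definition contractive_for ip A := forall f, ip (A f) (A f) <= ip f f.

(** The first clause of [resolvent] in abstract form. *)
Definition bounded_below ip A (l : R) := exists c : R, forall f,
  sip_norm ip f <= c * sip_norm ip (A f - l *: f).

Section sip_theory.
Variables (ip : V -> V -> R) (sip : semi_inner_product ip).
Local Notation nrm := (sip_norm ip).
Let ipC := sipC sip.
Let ipDl := sipDl sip.
Let ipZl := sipZl sip.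
Let ip_ge0 := sip_ge0 sip.

Lemma ipDr f g h : ip h (f + g) = ip h f + ip h g.
Proof. by rewrite ipC ipDl ![ip _ h]ipC. Qed.

Lemma ipZr a f h : ip h (a *: f) = a * ip h f.
Proof. by rewrite ipC ipZl ipC. Qed.

Lemma ipNl f h : ip (- f) h = - ip f h.
Proof. by rewrite -scaleN1r ipZl mulN1r. Qed.

Lemma ipNr f h : ip h (- f) = - ip h f.
Proof. by rewrite -scaleN1r ipZr mulN1r. Qed.

Lemma ip0l h : ip 0 h = 0.
Proof. by rewrite -(scale0r 0) ipZl mul0r. Qed.

Let ipE := (ipDl, ipDr, ipNl, ipNr, ipZl, ipZr).

Lemma ip_suml n (F : nat -> V) h :
  ip (\sum_(k < n) F k) h = \sum_(k < n) ip (F k) h.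
Proof.
by elim: n => [|n IH]; rewrite ?big_ord0 ?ip0l// !big_ord_recr/= ipDl IH.
Qed.

Lemma ip_sumr n (F : nat -> V) h :
  ip h (\sum_(k < n) F k) = \sum_(k < n) ip h (F k).
Proof. by rewrite ipC ip_suml; apply: eq_bigr => k _; rewrite ipC. Qed.

(** Cauchy-Schwarz from the nonnegativity of [P t = |f - t g|^2]. If [g] is a null vector, [P] is
    affine, and a nonzero [ip f g] would let it reach the value -1. *)
Lemma ip_sqr_le f g : ip f g ^+ 2 <= ip f f * ip g g.
Proof.
have P t : 0 <= ip f f - 2 * t * ip f g + t ^+ 2 * ip g g.
  have := ip_ge0 (f - t *: g); rewrite !ipE (ipC g f); lra.
have [g0|g0] := eqVneq (ip g g) 0.
  rewrite g0 mulr0 leNgt; apply/negP => fg.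
  have fg0 : ip f g != 0 by apply: contraTN fg => /eqP->; rewrite expr0n ltxx.
  have := P ((ip f f + 1) / (2 * ip f g)).
  have -> : 2 * ((ip f f + 1) / (2 * ip f g)) * ip f g = ip f f + 1 by field.
  rewrite g0; lra.
have gp : 0 < ip g g by rewrite lt_neqAle eq_sym g0 ip_ge0.
have := P (ip f g / ip g g).
have -> : ip f f - 2 * (ip f g / ip g g) * ip f g
    + (ip f g / ip g g) ^+ 2 * ip g g = (ip f f * ip g g - ip f g ^+ 2) / ip g g.
  by field.
by rewrite pmulr_lge0 ?invr_gt0// subr_ge0.
Qed.

Lemma sip_norm_ge0 f : 0 <= nrm f.
Proof. exact: sqrtr_ge0. Qed.
Local Notation nrm_ge0 := sip_norm_ge0.

Lemma sqr_sip_norm f : nrm f ^+ 2 = ip f f.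
Proof. by rewrite sqr_sqrtr. Qed.

Lemma abs_ip_le f g : `|ip f g| <= nrm f * nrm g.
Proof.
rewrite -(@ler_pXn2r _ 2)// ?nnegrE// ?mulr_ge0 ?nrm_ge0//.
by rewrite exprMn !sqr_sip_norm real_normK ?num_real// ip_sqr_le.
Qed.

Lemma ip_le f g : ip f g <= nrm f * nrm g.
Proof. exact: le_trans (ler_norm _) (abs_ip_le _ _). Qed.

Lemma sip_normD f g : nrm (f + g) <= nrm f + nrm g.
Proof.
rewrite -(@ler_pXn2r _ 2)// ?nnegrE// ?addr_ge0 ?nrm_ge0//.
rewrite sqr_sip_norm sqrrD !sqr_sip_norm !ipE (ipC g f).
have := ip_le f g; lra.
Qed.

Lemma sip_normZ a f : nrm (a *: f) = `|a| * nrm f.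
Proof. by rewrite /sip_norm !ipE mulrA -expr2 sqrtrM ?sqr_ge0// sqrtr_sqr. Qed.

Lemma sip_normN f : nrm (- f) = nrm f.
Proof. by rewrite -scaleN1r sip_normZ normrN1 mul1r. Qed.

Lemma sip_normB f g : nrm (f - g) <= nrm f + nrm g.
Proof. by rewrite -(sip_normN g) sip_normD. Qed.

Lemma sip_distC f g : nrm (f - g) = nrm (g - f).
Proof. by rewrite -sip_normN opprB. Qed.

Lemma sip_norm_le_add_dist f g : nrm f <= nrm g + nrm (f - g).
Proof. by rewrite -{1}(subrKC g f) sip_normD. Qed.

Lemma sip_norm_le f g : ip f f <= ip g g -> nrm f <= nrm g.
Proof. exact: ler_wsqrtr. Qed.

Lemma sip_norm0_ip f h : nrm f = 0 -> ip f h = 0.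
Proof.
by move=> f0; apply/eqP; rewrite -normr_le0 (le_trans (abs_ip_le _ _))// f0 mul0r.
Qed.

(** Weak linearity yields equalities only after pairing with an arbitrary vector; this turns them
    into equalities of norms. *)
Lemma eq_ip_sip_norm f g : (forall h, ip f h = ip g h) -> nrm f = nrm g.
Proof. by move=> fg; rewrite /sip_norm fg ipC fg. Qed.

Section operators.
Variable A : V -> V.

Lemma symmetric_weakly_linear : symmetric_for ip A -> weakly_linear ip A.
Proof. by move=> sA a f g h; rewrite !sA !ipE. Qed.

Hypothesis lA : weakly_linear ip A.

Lemma wlinD f g h : ip (A (f + g)) h = ip (A f) h + ip (A g) h.
Proof. by rewrite -{1}(scale1r f) lA mul1r. Qed.

Lemma wlin0 h : ip (A 0) h = 0.
Proof. by have := wlinD 0 0 h; rewrite addr0; lra. Qed.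

Lemma wlinZ a f h : ip (A (a *: f)) h = a * ip (A f) h.
Proof. by have := lA a f 0 h; rewrite wlin0 !addr0. Qed.

Lemma wlinB f g h : ip (A (f - g)) h = ip (A f) h - ip (A g) h.
Proof. by have := lA (-1) g f h; rewrite scaleN1r [- g + f]addrC; lra. Qed.

Lemma wlin_sum n (F : nat -> V) h :
  ip (A (\sum_(k < n) F k)) h = \sum_(k < n) ip (A (F k)) h.
Proof.
by elim: n => [|n IH]; rewrite ?big_ord0 ?wlin0// !big_ord_recr/= wlinD IH.
Qed.

Lemma sip_norm_wlinB f g : nrm (A f - A g) = nrm (A (f - g)).
Proof. by apply: eq_ip_sip_norm => h; rewrite wlinB !ipE. Qed.

Lemma ip_defect_sum n f h :
  ip (\sum_(k < n) iter k A f) h - ip (A (\sum_(k < n) iter k A f)) h =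
  ip (f - iter n A f) h.
Proof.
rewrite (wlin_sum n (fun k => iter k A f)) ip_suml -sumrB.
elim: n => [|n IH]; first by rewrite big_ord0 /= subrr ip0l.
by rewrite big_ord_recr/= IH !ipE; ring.
Qed.

Hypothesis cA : contractive_for ip A.

Lemma sip_norm_contractive f : nrm (A f) <= nrm f.
Proof. exact: sip_norm_le. Qed.

Lemma sip_norm_iter n f : nrm (iter n A f) <= nrm f.
Proof.
by elim: n => //= n IH; exact: le_trans (sip_norm_contractive _) IH.
Qed.

Lemma ip_defect_ge0 f : 0 <= ip (f - A f) f.
Proof.
rewrite !ipE subr_ge0 (le_trans (ip_le _ _))// -sqr_sip_norm expr2.
by rewrite ler_wpM2r ?nrm_ge0 ?sip_norm_contractive.
Qed.

Lemma bounded_below_gt1 l : 1 < l -> bounded_below ip A l.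
Proof.
move=> l1; exists (l - 1)^-1 => f; rewrite ler_pdivlMl; last lra.
have := sip_norm_le_add_dist (l *: f) (A f).
rewrite sip_distC sip_normZ ger0_norm; last lra.
have := sip_norm_contractive f; lra.
Qed.

(* The solution is the fixed point of the contraction f |-> (A f - g) / l. *)
Lemma resolvent_solution l : geometrically_complete ip -> 1 < l ->
  forall g, exists f, nrm (A f - l *: f - g) = 0.
Proof.
move=> cpl l1 g; have l0 : 0 < l by lra.
have q01 : 0 <= l^-1 < 1 by rewrite invr_ge0 (ltW l0) invf_lt1.
pose F f := l^-1 *: (A f - g).
pose u n := iter n F 0.
have FB x y : nrm (F x - F y) <= l^-1 * nrm (x - y).
  rewrite /F -scalerBr opprB addrA subrK sip_normZ.
  rewrite ger0_norm ?invr_ge0 ?(ltW l0)// ler_pM2l ?invr_gt0//.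
  by rewrite sip_norm_wlinB sip_norm_contractive.
have uC n : nrm (u n.+1 - u n) <= nrm (u 1%N - u 0%N) * l^-1 ^+ n.
  elim: n => [|n IH]; first by rewrite expr0 mulr1.
  rewrite (le_trans (FB _ _))// exprS mulrCA ler_wpM2l ?invr_ge0 ?(ltW l0)//.
have [v uv] := cpl _ _ _ q01 uC.
set D := _ / _ in uv.
exists v; apply/eqP; rewrite eq_le nrm_ge0 andbT.
apply: (@le_of_le_geometric _ _ _ (2 * D) _ q01) => n; rewrite add0r.
have -> : A v - l *: v - g = l *: (F v - v).
  rewrite /F scalerBr scalerA divff ?gt_eqF// scale1r.
  by rewrite addrAC.
rewrite sip_normZ gtr0_norm//.
(* [F v] is compared with [u n.+1 = F (u n)], so that both distances decay like [l^-1 ^+ n]. *)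
have h1 : nrm (F v - v) <= nrm (F v - u n.+1) + nrm (u n.+1 - v).
  by rewrite (le_trans _ (sip_normD _ _))// addrA subrK.
have h2 := FB v (u n); have h3 := uv n; have h4 := uv n.+1.
rewrite sip_distC in h3.
rewrite exprS in h4; rewrite -[F (u n)]/(u n.+1) in h2.
have h5 : nrm (F v - v) <= l^-1 * (2 * D * l^-1 ^+ n).
  apply: (le_trans h1).
  apply: (@le_trans _ _ (l^-1 * (D * l^-1 ^+ n) + D * (l^-1 * l^-1 ^+ n))).
    by apply: lerD => //; apply: (le_trans h2); rewrite ler_pM2l ?invr_gt0.
  lra.
by rewrite mulrC -ler_pdivlMr// mulrC.
Qed.

End operators.
End sip_theory.
End semi_inner_product.

(** * Spectral gap of a symmetric contraction *)

Section symmetric_contraction.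
Variables (R : realType) (V : lmodType R) (ip : V -> V -> R).
Hypothesis sip : semi_inner_product ip.
Local Notation nrm := (sip_norm ip).
Let ipC := sipC sip.
Let ip_ge0 := sip_ge0 sip.
Let ipE := (sipDl sip, ipDr sip, ipNl sip, ipNr sip, sipZl sip, ipZr sip).
Let nrm_ge0 := sip_norm_ge0 ip.

Variable A : V -> V.
Hypotheses (sA : symmetric_for ip A) (cA : contractive_for ip A).
Let lA : weakly_linear ip A := symmetric_weakly_linear sip sA.

Lemma bounded_belowW l : bounded_below ip A l ->
  exists2 c : R, 0 < c & forall f, nrm f <= c * nrm (A f - l *: f).
Proof.
move=> [c bc]; exists (`|c| + 1) => [|f]; first by rewrite ltr_wpDl.
rewrite (le_trans (bc f))// ler_wpM2r ?nrm_ge0//.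
by have := ler_norm c; lra.
Qed.

Section shifted.
Variables (c m : R).
Let D f := A f - c *: f.
Let q f g := ip (D f) (D g) - m * ip f g.

Let ip_D f g : ip (D f) (D g) =
  ip (A f) (A g) - 2 * c * ip f (A g) + c ^+ 2 * ip f g.
Proof. by rewrite /D !ipE (sA f g); ring. Qed.

Let D_bound f : ip (D f) (D f) <= (1 + `|c|) ^+ 2 * ip f f.
Proof.
rewrite -!(sqr_sip_norm sip) -exprMn ler_pXn2r ?nnegrE ?mulr_ge0 ?addr_ge0//.
rewrite mulrDl mul1r -(sip_normZ sip) (le_trans (sip_normB sip _ _))//.
by rewrite lerD2r (sip_norm_contractive cA).
Qed.

Hypothesis m0 : 0 <= m.
Hypothesis mD : forall f, m * ip f f <= ip (D f) (D f).

Let q_sip : semi_inner_product q.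
Proof.
split=> [f g|f g h|a f h|f]; rewrite /q ?subr_ge0 ?mD//.
- by rewrite ipC (ipC f).
- by rewrite !ip_D !ipE (wlinD lA); ring.
- by rewrite !ip_D !ipE (wlinZ lA); ring.
Qed.

(** The vector [w] represents [(D^2 - m) f], that is, [ip w h = q f h]. Cauchy-Schwarz for [q],
    which is nonnegative by [mD], gives [|w|^4 <= q f f * q w w], and
    [q w w <= |D w|^2 <= (1 + |c|)^2 |w|^2]. *)
Lemma factor_bound f w :
  w = A (A f - (c - Num.sqrt m) *: f) - (c + Num.sqrt m) *:
        (A f - (c - Num.sqrt m) *: f) ->
  ip w w <= (1 + `|c|) ^+ 2 * (ip (D f) (D f) - m * ip f f).
Proof.
set r := Num.sqrt m => wE.
have wq h : ip w h = q f h.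
  have rm : m = r ^+ 2 by rewrite sqr_sqrtr.
  rewrite wE /q ip_D rm !ipE (sA (A f - _) h) !ipE (sA f h); ring.
have ww : ip w w = q f w by rewrite wq.
have := ip_sqr_le q_sip f w; rewrite -ww => H.
have qww : q w w <= (1 + `|c|) ^+ 2 * ip w w.
  by rewrite (le_trans _ (D_bound w))// /q lerBlDr lerDl mulr_ge0 ?ip_ge0.
have qff : 0 <= q f f := sip_ge0 q_sip f.
rewrite -/(q f f).
have [->|w0] := eqVneq (ip w w) 0; first by rewrite mulr_ge0 ?sqr_ge0.
have wp : 0 < ip w w by rewrite lt_neqAle eq_sym w0 ip_ge0.
rewrite -(@ler_pM2r _ (ip w w))// -expr2 (le_trans H)//.
by rewrite mulrAC mulrC; rewrite ler_wpM2r.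
Qed.

End shifted.

(* If [c - r] and [c + r] are regular for all [r < rho], then [(A - c)^2] has no
   spectrum below [rho^2]: its infimum [m] would be an approximate eigenvalue. *)
Lemma ip_factors_ge0 a b : a < b ->
  (forall l, a < l < b -> bounded_below ip A l) ->
  forall f, 0 <= ip (A f - a *: f) (A f - b *: f).
Proof.
move=> ab bb f.
pose c := (a + b) / 2; pose rho := (b - a) / 2.
pose D f := A f - c *: f.
(* The product [(A - a) (A - b)] equals [D^2 - rho^2], so the claim is a lower bound on [D]. *)
suff Dge g : rho ^+ 2 * ip g g <= ip (D g) (D g).
  have := Dge f; rewrite /D /c /rho !ipE (ipC f (A f)); lra.
rewrite leNgt; apply/negP => gD.
have g0 : 0 < ip g g.
  rewrite lt_neqAle ip_ge0 andbT eq_sym; apply/eqP => g0.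
  by move: gD; rewrite g0 mulr0 ltNge ip_ge0.
pose Q := [set ip (D f) (D f) / ip f f | f in [set f | 0 < ip f f]].
have Qg : Q (ip (D g) (D g) / ip g g) by exists g.
have lQ : has_lbound Q.
  by exists 0 => _ [h /= h0 <-]; rewrite divr_ge0 ?ip_ge0.
have iQ : has_inf Q by split=> //; exists (ip (D g) (D g) / ip g g).
pose m := inf Q.
have m0 : 0 <= m.
  apply: lb_le_inf => [|_ [h /= h0 <-]]; last by rewrite divr_ge0 ?ip_ge0.
  by exists (ip (D g) (D g) / ip g g).
have mr : m < rho ^+ 2.
  by rewrite (le_lt_trans (ge_inf lQ Qg))// ltr_pdivrMr.
have mD h : m * ip h h <= ip (D h) (D h).
  have [->|h0] := eqVneq (ip h h) 0; first by rewrite mulr0 ip_ge0.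
  have hp : 0 < ip h h by rewrite lt_neqAle eq_sym h0 ip_ge0.
  by rewrite -ler_pdivlMr//; apply: ge_inf => //; exists h.
have rho0 : 0 < rho by rewrite /rho; lra.
have r0 := sqrtr_ge0 m.
have rr : Num.sqrt m < rho.
  by rewrite -(@ltr_pXn2r _ 2)// ?nnegrE ?(ltW rho0)// sqr_sqrtr.
(* As [sqrt m < rho], both [c - sqrt m] and [c + sqrt m] lie strictly between [a] and [b]. *)
have [c1 c10 b1] : exists2 c1 : R, 0 < c1 &
    forall f, nrm f <= c1 * nrm (A f - (c - Num.sqrt m) *: f).
  by apply/bounded_belowW/bb; move: rr; rewrite /c /rho => rr; apply/andP; split; lra.
have [c2 c20 b2] : exists2 c1 : R, 0 < c1 &
    forall f, nrm f <= c1 * nrm (A f - (c + Num.sqrt m) *: f).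
  by apply/bounded_belowW/bb; move: rr; rewrite /c /rho => rr; apply/andP; split; lra.
pose C := (c1 * c2) ^+ 2 * (1 + `|c|) ^+ 2.
have C0 : 0 < C.
  by apply: mulr_gt0; rewrite exprn_gt0 ?mulr_gt0 ?ltr_pwDl.
(* The two lower bounds and [factor_bound] allow [m] to be raised by [C^-1], against its choice as
   an infimum. *)
have key h : (m + C^-1) * ip h h <= ip (D h) (D h).
  pose w := A (A h - (c - Num.sqrt m) *: h) - (c + Num.sqrt m) *:
    (A h - (c - Num.sqrt m) *: h).
  have H : ip w w <= _ := factor_bound m0 mD erefl.
  have H1 : nrm h <= c1 * c2 * nrm w.
    rewrite (le_trans (b1 h))// -mulrA ler_pM2l//; exact: b2.
  have H2 : ip h h <= C * (ip (D h) (D h) - m * ip h h).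
    rewrite -[leLHS](sqr_sip_norm sip) /C -mulrA.
    apply: (@le_trans _ _ ((c1 * c2 * nrm w) ^+ 2)).
      by rewrite ler_pXn2r ?nnegrE ?mulr_ge0// ltW.
    by rewrite exprMn ler_pM2l ?exprn_gt0 ?mulr_gt0// (sqr_sip_norm sip).
  by rewrite mulrDl -lerBrDl ler_pdivrMl.
have : m + C^-1 <= m.
  apply: lb_le_inf => [|_ [h /= h0 <-]]; first by exists (ip (D g) (D g) / ip g g).
  by rewrite ler_pdivlMr.
by rewrite gerDl leNgt invr_gt0 C0.
Qed.

Section gap.
Variable one : V.
Hypotheses (A1 : nrm (A one - one) = 0) (one1 : ip one one = 1).
Hypothesis simple1 : forall f, nrm (A f - f) = 0 ->
  exists c : R, nrm (f - c *: one) = 0.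
Hypothesis cpl : geometrically_complete ip.
Variable a : R.
Hypotheses (a1 : a < 1)
  (bb : forall l, a < l < 1 -> bounded_below ip A l).

Let S f := f - A f.

(** Case [b = 1] of [ip_factors_ge0], with [A - 1 = - S] and [A - a = (1 - a) - S]. *)
Let S_ge f : (1 - a) * ip (S f) f <= ip (S f) (S f).
Proof.
have := ip_factors_ge0 a1 bb f; rewrite /S scale1r !ipE (ipC f (A f)); lra.
Qed.

(** The range of [S], up to null vectors. *)
Let W w := exists x, forall h, ip w h = ip (S x) h.

(** For [w = S x], Cauchy-Schwarz for the form [<S _, _>] gives
    [|w|^4 = <S x, w>^2 <= <S x, x> <S w, w>], and [S_ge] bounds [(1 - a) <S x, x>] by [|w|^2]. *)
Let W_coercive w : W w -> (1 - a) * ip w w <= ip (S w) w.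
Proof.
move=> [x wx].
have sipS : semi_inner_product (fun f g => ip (S f) g).
  split=> [f g|f g h|b f h|f]; rewrite /S.
  - by rewrite !ipE sA (ipC g) (ipC (A g)).
  - by rewrite !ipE (wlinD lA); ring.
  - by rewrite !ipE (wlinZ lA); ring.
  - exact: (ip_defect_ge0 sip cA).
have ww : ip w w = ip (S x) w by rewrite wx.
have /= := ip_sqr_le sipS x w; rewrite -ww => H.
have Sx : (1 - a) * ip (S x) x <= ip w w.
  by rewrite ww (ipC _ w) wx; exact: S_ge.
have Sw0 : 0 <= ip (S w) w by exact: (ip_defect_ge0 sip cA).
have [->|w0] := eqVneq (ip w w) 0; first by rewrite mulr0.
have wp : 0 < ip w w by rewrite lt_neqAle eq_sym w0 ip_ge0.
rewrite -(@ler_pM2r _ (ip w w))// -mulrA -expr2.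
apply: (@le_trans _ _ ((1 - a) * (ip (S x) x * ip (S w) w))).
  by rewrite ler_pM2l// subr_gt0.
by rewrite mulrA mulrC ler_wpM2l.
Qed.

Let WB v w : W v -> W w -> W (v - w).
Proof.
move=> [x vx] [y wy]; exists (x - y) => h.
by rewrite !ipE vx wy /S !ipE (wlinB lA); ring.
Qed.

Let WZ b w : W w -> W (b *: w).
Proof.
by move=> [x wx]; exists (b *: x) => h; rewrite !ipE wx /S !ipE (wlinZ lA); ring.
Qed.

Let q01 : 0 <= (2^-1 : R) < 1.
Proof. by rewrite invr_ge0 ler0n invf_lt1 ?ltr0n ?ltr1n. Qed.

(** The inequality is known on the range of [S]. The ergodic averages [v n] differ from [f] by
    elements of that range and tend to 0, so it extends to [f]. *)
Lemma gap_coercive f : ip f one = 0 -> (1 - a) * ip f f <= ip (f - A f) f.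
Proof.
move=> f1.
(* [f - A^k f] is the image under [S] of [f + A f + ... + A^(k-1) f]. *)
have Wit k : W (f - iter k A f).
  elim: k => [|k [x fx]].
    by exists 0 => h; rewrite /= subrr /S !ipE (wlin0 lA) (ip0l sip) subr0.
  exists (x + iter k A f) => h; rewrite /=.
  have := fx h; rewrite /S !ipE (wlinD lA); lra.
have Wsum N : W (\sum_(k < N) (f - iter k A f)).
  elim: N => [|N IH]; first by rewrite big_ord0 -(subrr f); exact: (Wit 0%N).
  rewrite big_ord_recr/= -[X in _ + X]opprK; apply: WB => //.
  by rewrite -(scaleN1r (f - iter N A f)); apply: WZ; exact: Wit.
have qn0 n : 0 <= 2^-1 ^+ n :> R by rewrite exprn_ge0//; case/andP: q01.
(* Averaging over [2 ^ n] iterates makes [S (v n) = 2^-n (f - A^(2^n) f)] geometrically small. *)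
pose v n : V := (2^-1 ^+ n) *: \sum_(k < 2 ^ n) iter k A f.
have Wv n : W (f - v n).
  have -> : f - v n = (2^-1 ^+ n) *: \sum_(k < 2 ^ n) (f - iter k A f).
    rewrite sumrB scalerBr sumr_const card_ord -[f *+ _]scaler_nat scalerA natrX -exprMn.
    by rewrite mulVf ?pnatr_eq0// expr1n scale1r.
  by apply: WZ; exact: Wsum.
have Sv n : nrm (S (v n)) <= 2 * nrm f * 2^-1 ^+ n.
  have -> : nrm (S (v n)) = nrm (2^-1 ^+ n *: (f - iter (2 ^ n) A f)).
    apply: (eq_ip_sip_norm sip) => h.
    by rewrite /S /v !ipE (wlinZ lA) -mulrBr (ip_defect_sum sip lA) !ipE.
  rewrite (sip_normZ sip) (ger0_norm (qn0 n)).
  rewrite mulrC ler_wpM2r//.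
  rewrite (le_trans (sip_normB sip _ _))//.
  by have := sip_norm_iter cA (2 ^ n) f; lra.
have coer w : W w -> (1 - a) * nrm w <= nrm (S w).
  move=> Ww; have [w0|w0] := eqVneq (nrm w) 0; first by rewrite w0 mulr0.
  have wp : 0 < nrm w by rewrite lt_neqAle eq_sym w0 nrm_ge0.
  rewrite -(ler_pM2r wp) -mulrA -expr2 (sqr_sip_norm sip).
  exact: le_trans (W_coercive Ww) (ip_le sip _ _).
(* The increment lies in the range of [S], where [coer] bounds its norm by that of its image under
   [S]. *)
have vv n : nrm (v n.+1 - v n) <= 4 * nrm f / (1 - a) * 2^-1 ^+ n.
  rewrite mulrAC ler_pdivlMr ?subr_gt0// mulrC.
  have Wn : W (v n.+1 - v n).
    have -> : v n.+1 - v n = (f - v n) - (f - v n.+1).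
      by rewrite opprB [RHS]addrC addrA subrK.
    exact: WB.
  apply: (le_trans (coer _ Wn)).
  have -> : nrm (S (v n.+1 - v n)) = nrm (S (v n.+1) - S (v n)).
    by apply: (eq_ip_sip_norm sip) => h; rewrite /S !ipE (wlinB lA); ring.
  apply: (le_trans (sip_normB sip _ _)).
  have := Sv n; have := Sv n.+1; rewrite exprS.
  have := nrm_ge0 f; set F := nrm f => F0.
  have := qn0 n; set e := 2^-1 ^+ n => e0.
  have := mulr_ge0 F0 e0; lra.
have [u vu] := cpl q01 vv.
set D := _ / (1 - _) in vu.
have Av0 : nrm (A u - u) = 0.
  apply/eqP; rewrite eq_le nrm_ge0 andbT.
  apply: (@le_of_le_geometric _ _ _ (2 * D + 2 * nrm f) _ q01) => n; rewrite add0r.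
  have -> : A u - u = (A u - A (v n)) - S (v n) + (v n - u).
    by rewrite /S opprB !addrA subrK subrK.
  apply: (le_trans (sip_normD sip _ _)).
  have -> : (2 * D + 2 * nrm f) * 2^-1 ^+ n =
      D * 2^-1 ^+ n + 2 * nrm f * 2^-1 ^+ n + D * 2^-1 ^+ n by ring.
  apply: lerD; last exact: vu.
  apply: (le_trans (sip_normB sip _ _)); apply: lerD; last exact: Sv.
  rewrite (sip_norm_wlinB sip lA) (le_trans (sip_norm_contractive cA _))//.
  by rewrite (sip_distC sip) vu.
(* The limit [u] is fixed by [A], hence a multiple of [one]. It is also orthogonal to [one], as
   every [v n] is, so the multiple is 0. *)
have [c uc] := simple1 Av0.
have it1 k h : ip (iter k A h) one = ip h one.
  elim: k => //= k <-; rewrite sA.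
  have := sip_norm0_ip sip (iter k A h) A1.
  by rewrite !ipE ![ip _ (iter _ _ _)]ipC => /eqP; rewrite subr_eq0 => /eqP.
have v1 n : ip (v n) one = 0.
  rewrite /v !ipE (ip_suml sip) big1 ?mulr0// => k _.
  by rewrite it1.
have u1 : ip u one = 0.
  apply/eqP; rewrite -normr_le0.
  apply: (@le_of_le_geometric _ _ _ D _ q01) => n; rewrite add0r.
  have -> : ip u one = - ip (v n - u) one.
    by rewrite (sipDl sip) (ipNl sip) v1 add0r opprK.
  rewrite normrN (le_trans (abs_ip_le sip _ _))//.
  by rewrite {2}/sip_norm one1 sqrtr1 mulr1 vu.
have c0 : c = 0.
  have := sip_norm0_ip sip one uc; rewrite !ipE u1 one1; lra.
move: uc; rewrite c0 scale0r subr0 => u0.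
have vn n : nrm (v n) <= D * 2^-1 ^+ n.
  by have := sip_norm_le_add_dist sip (v n) u; have := vu n; rewrite u0; lra.
(* Expanding the inequality for [f - v n], every cross term is at most a constant times [|v n|],
   hence of order [2^-1 ^+ n]. The three summands of the constant collect these terms. *)
apply: (@le_of_le_geometric _ _ _
  (2 * (1 - a) * nrm f * D + 4 * nrm f * D + 2 * D * D) _ q01) => n.
have := W_coercive (Wv n).
have -> : ip (S (f - v n)) (f - v n) =
    ip (S f) f - ip (S f) (v n) - ip (S (v n)) f + ip (S (v n)) (v n).
  by rewrite /S !ipE !(wlinB lA); ring.
have -> : ip (f - v n) (f - v n) = ip f f - 2 * ip f (v n) + ip (v n) (v n).
  by move: (v n) => w; rewrite !ipE (ipC w f); ring.
have nS g : nrm (S g) <= 2 * nrm g.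
  rewrite (le_trans (sip_normB sip _ _))//.
  by have := sip_norm_contractive cA g; lra.
have F0 := nrm_ge0 f; have e0 := nrm_ge0 (v n).
have D0 : 0 <= D by have := vu 0%N; rewrite expr0 mulr1; apply: le_trans.
have qn1 : 2^-1 ^+ n <= 1 :> R by rewrite exprn_ile1//; case/andP: q01 => // _ /ltW.
have eD : nrm (v n) <= D by rewrite (le_trans (vn n))// ler_piMr.
have a1' : 0 < 1 - a by rewrite subr_gt0.
have h1 : ip f (v n) <= nrm f * nrm (v n) by exact: ip_le.
have h2 : - ip (S f) (v n) <= 2 * (nrm f * nrm (v n)).
  rewrite (le_trans (ler_norm _))// normrN (le_trans (abs_ip_le sip _ _))//.
  by rewrite mulrA ler_wpM2r.
have h3 : - ip (S (v n)) f <= 2 * (nrm f * nrm (v n)).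
  rewrite (le_trans (ler_norm _))// normrN (le_trans (abs_ip_le sip _ _))//.
  by rewrite [nrm f * _]mulrC mulrA ler_wpM2r.
have h4 : ip (S (v n)) (v n) <= 2 * (D * nrm (v n)).
  rewrite (le_trans (ip_le sip _ _))// mulrA ler_wpM2r//.
  by rewrite (le_trans (nS _))// ler_pM2l.
have h5 := ip_ge0 (v n).
have h6 : nrm f * nrm (v n) <= nrm f * (D * 2^-1 ^+ n) by rewrite ler_wpM2l.
have h7 : D * nrm (v n) <= D * (D * 2^-1 ^+ n) by rewrite ler_wpM2l.
have h8 : (1 - a) * ip f (v n) <= (1 - a) * (nrm f * (D * 2^-1 ^+ n)).
  by rewrite ler_pM2l// (le_trans h1).
have h9 : 0 <= (1 - a) * ip (v n) (v n) by rewrite mulr_ge0// ltW.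
lra.
Qed.
End gap.
End symmetric_contraction.

(** * Poisson's equation *)

Section poisson.
Variables (R : realType) (V : lmodType R) (ip : V -> V -> R).
Hypothesis sip : semi_inner_product ip.
Local Notation nrm := (sip_norm ip).
Let ipE := (sipDl sip, ipDr sip, ipNl sip, ipNr sip, sipZl sip, ipZr sip).
Let nrm_ge0 := sip_norm_ge0 ip.

Variables (T : V -> V) (one : V).
Hypotheses (lT : weakly_linear ip T) (cT : contractive_for ip T).
Hypothesis T1 : forall f, ip (T f) one = ip f one.

(** A priori estimate for Poisson's equation [w - T w = f] on the orthogonal of the constants. It is
    the form in which a gap enters the variance bound. *)
Definition poisson_bound (c : R) := forall w, ip w one = 0 ->
  nrm w <= c * nrm (w - T w).

Lemma coercive_poisson_bound g : 0 < g ->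
  (forall w, ip w one = 0 -> g * ip w w <= ip (w - T w) w) ->
  poisson_bound g^-1.
Proof.
move=> g0 co w w1; rewrite ler_pdivlMl//.
have [->|w0] := eqVneq (nrm w) 0; first by rewrite mulr0.
have wp : 0 < nrm w by rewrite lt_neqAle eq_sym w0 nrm_ge0.
rewrite -(ler_pM2r wp) -mulrA -expr2 (sqr_sip_norm sip).
exact: le_trans (co _ w1) (ip_le sip _ _).
Qed.

Lemma sip_dist_iter k w : nrm (w - iter k T w) <= k%:R * nrm (w - T w).
Proof.
elim: k => [|k IH]; first by rewrite subrr mul0r /sip_norm (ip0l sip) sqrtr0.
have -> : w - iter k.+1 T w = (w - T w) + (T w - T (iter k T w)).
  by rewrite addrA subrK.
rewrite (le_trans (sip_normD sip _ _))// -natr1 mulrDl mul1r addrC lerD2r.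
by rewrite (sip_norm_wlinB sip lT) (le_trans (sip_norm_contractive cT _)).
Qed.

(* [|w|^2 - |T^k w|^2] factors as [(|w| - |T^k w|) (|w| + |T^k w|)]. *)
Lemma iter_coercive_poisson_bound k g : 0 < g ->
  (forall w, ip w one = 0 ->
    g * ip w w <= ip w w - ip (iter k T w) (iter k T w)) ->
  poisson_bound (2 * k%:R / g).
Proof.
move=> g0 co w w1; rewrite mulrAC ler_pdivlMr// mulrC.
have [->|w0] := eqVneq (nrm w) 0; first by rewrite mulr0 !mulr_ge0.
have wp : 0 < nrm w by rewrite lt_neqAle eq_sym w0 nrm_ge0.
rewrite -(ler_pM2r wp) -mulrA -expr2 (sqr_sip_norm sip).
apply: (le_trans (co _ w1)); rewrite -!(sqr_sip_norm sip) subr_sqr.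
have h1 := sip_norm_le_add_dist sip w (iter k T w).
have h2 := sip_norm_iter cT k w.
have h3 := sip_dist_iter k w.
have := nrm_ge0 (iter k T w); set y := nrm (iter k T w) in h1 h2 *.
set D := nrm (w - T w) in h3 *; set x := nrm w in h1 h2 wp *.
move=> y0; have [] : 0 <= x - y /\ x - y <= k%:R * D by split; lra.
move=> xy0 xyk.
apply: (@le_trans _ _ ((x - y) * (2 * x))); first by rewrite ler_wpM2l//; lra.
have : (x - y) * x <= k%:R * D * x by rewrite ler_pM2r.
lra.
Qed.

Variable c : R.
Hypotheses (c0 : 0 <= c) (pc : poisson_bound c).

Lemma ip_iter1 k f : ip (iter k T f) one = ip f one.
Proof. by elim: k => //= k <-. Qed.

(** The partial sum [s] is orthogonal to [one], and [s - T s = f - T^n f] has norm at most [2 |f|]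
    whatever [n] is; [pc] then bounds [s] itself. *)
Lemma correlation_sum_le f n : ip f one = 0 ->
  ip f (\sum_(k < n) iter k T f) <= 2 * c * ip f f.
Proof.
move=> f1; set s := \sum_(k < n) _.
have s1 : ip s one = 0 by rewrite (ip_suml sip) big1// => k _; rewrite ip_iter1.
have Ss : nrm (s - T s) <= 2 * nrm f.
  have -> : nrm (s - T s) = nrm (f - iter n T f).
    by apply: (eq_ip_sip_norm sip) => h; rewrite -(ip_defect_sum sip lT) !ipE.
  rewrite (le_trans (sip_normB sip _ _))//.
  by have := sip_norm_iter cT n f; lra.
rewrite (le_trans (ip_le sip _ _))// -(sqr_sip_norm sip) expr2 mulrA mulrC.
rewrite ler_wpM2r// (le_trans (pc s1))// [2 * c]mulrC -mulrA.
by rewrite ler_wpM2l.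
Qed.

(** Passing from [n] to [n + 1] terms adds [|f|^2 + 2 S], where [S] is the sum of [<f, T^k f>] over
    [1 <= k <= n]. This is at most [2 (|f|^2 + S)], which [correlation_sum_le] bounds by
    [4 c |f|^2]. *)
Lemma stationary_sum_le (V' : lmodType R) (ip' : V' -> V' -> R)
    (sip' : semi_inner_product ip') (X : nat -> V') f : ip f one = 0 ->
  (forall i k, ip' (X i) (X (i + k)%N) = ip f (iter k T f)) ->
  forall n, ip' (\sum_(i < n) X i) (\sum_(i < n) X i) <= 4 * c * n%:R * ip f f.
Proof.
move=> f1 Xf; elim=> [|n IH]; first by rewrite big_ord0 (ip0l sip') mulr0 mul0r.
rewrite big_ord_recr/= !(sipDl sip', ipDr sip').
rewrite (sipC sip' (X n) (\sum_(i < n) X i)).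
have -> : ip' (\sum_(i < n) X i) (X n) = \sum_(k < n) ip f (iter k.+1 T f).
  rewrite (ip_suml sip').
  (* After reversal the index [n - k - 1] is at lag [k + 1] from [n]. *)
  rewrite (reindex_inj rev_ord_inj)/=; apply: eq_bigr => k _.
  by rewrite -[T (iter _ T f)]/(iter (k.+1) T f) -(Xf (n - k.+1)%N) subnK.
have := Xf n 0%N; rewrite addn0/= => ->.
have := correlation_sum_le n.+1 f1; rewrite big_ord_recl/= (ipDr sip).
have -> : ip f (\sum_(i < n) T (iter i T f)) = \sum_(i < n) ip f (T (iter i T f)).
  exact: (ip_sumr sip n (fun i => T (iter i T f))).
have := sip_ge0 sip f; move: IH; rewrite -natr1.
set S := \sum_(i < n) ip f _; lra.
Qed.

End poisson.

(** * The space L2(P) *)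

Lemma sip_norm_geometric (R : realType) (V : lmodType R) (ip : V -> V -> R)
    (sip : semi_inner_product ip) (q C : R) (u : nat -> V) : 0 <= q < 1 -> 0 <= C ->
  (forall n, sip_norm ip (u n.+1 - u n) <= C * q ^+ n) ->
  forall n m, (n <= m)%N -> sip_norm ip (u n - u m) <= C / (1 - q) * q ^+ n.
Proof.
move=> /andP[q0 q1] C0 uC n m /subnK<-; move: (m - n)%N => {m} k.
have D0 : 0 <= C / (1 - q) by rewrite divr_ge0// subr_ge0 ltW.
(* The factor [1 - q ^+ k] makes the bound inductive in the number [k] of steps. *)
suff : sip_norm ip (u n - u (k + n)%N) <= C / (1 - q) * (1 - q ^+ k) * q ^+ n.
  move/le_trans; apply; rewrite ler_wpM2r ?exprn_ge0// ler_piMr// gerBl.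
  exact: exprn_ge0.
elim: k => [|k IH].
  by rewrite subrr /sip_norm (ip0l sip) sqrtr0 expr0 subrr mulr0 mul0r.
have -> : u n - u (k.+1 + n)%N = (u n - u (k + n)%N) + (u (k + n)%N - u (k + n).+1).
  by rewrite addrA subrK.
rewrite (le_trans (sip_normD sip _ _))//.
apply: (@le_trans _ _ (C / (1 - q) * (1 - q ^+ k) * q ^+ n + C * q ^+ (k + n))).
  by apply: lerD => //; rewrite (sip_distC sip).
rewrite exprD exprS le_eqVlt; apply/orP; left; apply/eqP.
by field; rewrite subr_eq0 gt_eqF.
Qed.

Lemma eq_lee (R : realType) (x y : \bar R) : x = y -> (x <= y)%E.
Proof. by move=> ->. Qed.

Section square_integrable.
Context d {X : measurableType d} {R : realType}.
Variable mu : {measure set X -> \bar R}.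

Lemma Lfun2P (f : X -> R) : f \in Lfun mu 2%:E <->
  measurable_fun setT f /\ (\int[mu]_x (f x ^+ 2)%:E < +oo)%E.
Proof.
split=> [f2|[mf f2]].
  split; first by move: f2; rewrite inE => /andP[]; rewrite inE.
  have /integrableP[_] := Lfun2_integrable_sqr f2; apply: le_lt_trans.
  by under [leRHS]eq_integral do rewrite /= ger0_norm ?sqr_ge0//.
rewrite inE; apply/andP; rewrite !inE; split => //=.
rewrite /finite_norm unlock /= poweR_lty//.
by under eq_integral do rewrite /= powR_mulrn// real_normK ?num_real//.
Qed.

Lemma Lfun2_measurable (f : X -> R) : f \in Lfun mu 2%:E -> measurable_fun setT f.
Proof. by move=> /Lfun2P[]. Qed.

Lemma Lfun2_mulr_integrable (f g : X -> R) :
  f \in Lfun mu 2%:E -> g \in Lfun mu 2%:E ->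
  mu.-integrable setT (EFin \o (f \* g)).
Proof. by move=> f2 g2; apply/Lfun1_integrable/Lfun2_mul_Lfun1. Qed.

Lemma Lnorm2E (f : X -> R) : f \in Lfun mu 2%:E ->
  'N[mu]_2%:E[EFin \o f]%E = (Num.sqrt (\int[mu]_x (f x * f x)))%:E.
Proof.
move=> f2; rewrite unlock /= -powR12_sqrt; last first.
  by apply: Rintegral_ge0 => x _; rewrite -expr2 sqr_ge0.
rewrite -poweR_EFin; congr (_ `^ _)%E.
rewrite fineK; last exact/integrable_fin_num/(Lfun2_mulr_integrable f2 f2).
apply: eq_integral => x _ /=.
by rewrite powR_mulrn// real_normK ?num_real// expr2.
Qed.

(** Hoelder's inequality against the constant 1, which has norm 1 since the total mass is 1. *)
Lemma integral_abs_le_Lnorm2 (f : X -> R) : mu setT = 1%E ->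
  measurable_fun setT f -> (\int[mu]_x `|f x|%:E <= 'N[mu]_2%:E[EFin \o f])%E.
Proof.
move=> mu1 mf.
have e2 : 2^-1 + 2^-1 = 1 :> R by rewrite [RHS]splitr !div1r.
have := @hoelder _ _ _ mu f (cst 1%R) 2 2 mf (measurable_cst _)
  (ltr0Sn _ 1) (ltr0Sn _ 1) e2.
have -> : 'N[mu]_2%:E[EFin \o cst 1%R]%E = 1%E.
  transitivity (mu setT `^ 2^-1)%E; first exact: Lnorm_cst1.
  by rewrite mu1 poweR1r.
rewrite mule1 Lnorm1; apply: le_trans.
by apply/eq_lee/eq_integral => x _; rewrite /= mulr1.
Qed.

End square_integrable.

Section L2.
Context d {X : measurableType d} {R : realType}.
Variable P : probability X R.

(** Elements are functions and not classes modulo null sets, so that [L2_inner] is only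
    semi-definite. *)
Definition L2 := LfunType P (lee1n 2).

Definition L2_inner (f g : L2) : R := \int[P]_x (f x * g x).

Lemma L2_inner_integrable (f g : L2) :
  P.-integrable setT (EFin \o (fun x => f x * g x)).
Proof. exact: (Lfun2_mulr_integrable (LfunP f) (LfunP g)). Qed.

Lemma L2_semi_inner_product : semi_inner_product L2_inner.
Proof.
split=> [f g|f g h|a f h|f]; rewrite /L2_inner.
- by apply: eq_Rintegral => x _; rewrite mulrC.
- rewrite -RintegralD//; try exact: L2_inner_integrable.
  by apply: eq_Rintegral => x _; rewrite -mulrDl.
- rewrite -RintegralZl//; try exact: L2_inner_integrable.
  by apply: eq_Rintegral => x _; rewrite mulrA.
- by apply: Rintegral_ge0 => x _; rewrite -expr2 sqr_ge0.
Qed.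

Lemma L2_normE (f : L2) :
  'N[P]_2%:E[EFin \o f]%E = (sip_norm L2_inner f)%:E.
Proof. exact/Lnorm2E/LfunP. Qed.

Lemma L2_inner_sqrE (f : L2) :
  (L2_inner f f)%:E = (\int[P]_x (f x ^+ 2)%:E)%E.
Proof.
rewrite fineK; last exact/integrable_fin_num/L2_inner_integrable.
by apply: eq_integral => x _; rewrite expr2.
Qed.

Lemma L2_dist0P (f g : L2) :
  sip_norm L2_inner (f - g) = 0 <-> (f : X -> R) = g %[ae P].
Proof.
have fgE x : (f - g) x = f x - g x by [].
split=> [fg0|fg].
  have : fine ('N[P]_2%:E[EFin \o (f - g)%R]%E) = 0 by rewrite L2_normE fg0.
  move/fine_Lnormr_eq0; apply: filterS => x /(_ I)/eqP.
  by rewrite fgE subr_eq0 => /eqP.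
rewrite /sip_norm; apply/eqP; rewrite sqrtr_eq0 -lee_fin L2_inner_sqrE.
rewrite (ge0_ae_eq_integral (g := cst 0%E))//.
- by rewrite integral0.
- by apply/measurable_EFinP/measurable_funX.
- by move=> x _; rewrite lee_fin sqr_ge0.
- apply: filterS fg => x /(_ I) fgx _.
  transitivity ((f x - g x) ^+ 2)%:E => //.
  by rewrite fgx subrr expr0n.
Qed.

End L2.

(** * Completeness of L2(P) *)

Lemma sum_geometric_le (R : realType) (q C : R) n : 0 <= q < 1 -> 0 <= C ->
  \sum_(k < n) C * q ^+ k <= C / (1 - q).
Proof.
move=> /andP[q0 q1] C0.
have -> : \sum_(k < n) C * q ^+ k = C * (1 - q ^+ n) / (1 - q).
  elim: n => [|n IH]; first by rewrite big_ord0 expr0 subrr mulr0 mul0r.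
  by rewrite big_ord_recr/= IH exprS; field; rewrite subr_eq0 gt_eqF.
rewrite ler_pM2r ?invr_gt0 ?subr_gt0// ler_piMr// gerBl; exact: exprn_ge0.
Qed.

Section L2_complete.
Context d {X : measurableType d} {R : realType}.
Variable P : probability X R.
Local Notation nrm := (sip_norm (@L2_inner _ X R P)).
Local Notation L2 := (L2 P).
Let sip := L2_semi_inner_product P.

Lemma integral_abs_L2_le (f : L2) : (\int[P]_x `|f x|%:E <= (nrm f)%:E)%E.
Proof.
rewrite -L2_normE; apply: integral_abs_le_Lnorm2; first exact: probability_setT.
exact/Lfun2_measurable/LfunP.
Qed.

Section sequence.
Variables (q C : R) (u : nat -> L2).
Hypotheses (q01 : 0 <= q < 1) (uC : forall n, nrm (u n.+1 - u n) <= C * q ^+ n).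

Let mu n : measurable_fun setT (u n).
Proof. exact/Lfun2_measurable/LfunP. Qed.

Let C0 : 0 <= C.
Proof.
by have := uC 0%N; rewrite expr0 mulr1; apply: le_trans; exact: sip_norm_ge0.
Qed.

Let D n x := `|u n.+1 x - u n x|%:E.

Let D0 n x : (0 <= D n x)%E.
Proof. by rewrite lee_fin. Qed.

Let mD n : measurable_fun setT (D n).
Proof.
by apply/measurable_EFinP/measurableT_comp => //; exact: measurable_funB.
Qed.

(** The mean of an absolute increment is at most its L2 norm, so the total variation of the sequence
    has mean at most [C / (1 - q)]. It is thus finite almost everywhere, and the sequence converges
    there. *)
Let sumD_lty : (\int[P]_x (\sum_(n <oo) D n x) < +oo)%E.
Proof.
rewrite integral_nneseries//.
apply: (@le_lt_trans _ _ (C / (1 - q))%:E); last exact: ltry.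
apply: lime_le.
  by apply: is_cvg_nneseries => n _ _; apply: integral_ge0 => x _; rewrite lee_fin.
apply: nearW => n; rewrite big_mkord.
apply: (@le_trans _ _ (\sum_(k < n) (C * q ^+ k)%:E)%E).
  apply: lee_sum => k _; apply: (le_trans (integral_abs_L2_le (u k.+1 - u k))).
  by rewrite lee_fin uC.
by rewrite sumEFin lee_fin sum_geometric_le.
Qed.

Let ae_cvg : {ae P, forall x, exists l : R, u ^~ x @ \oo --> l}.
Proof.
have iD : P.-integrable setT (fun x => \sum_(n <oo) D n x)%E.
  apply/integrableP; split.
    exact: ge0_emeasurable_sum.
  under eq_integral => x _ do rewrite (gee0_abs (nneseries_ge0 (fun n _ _ => D0 n x))).
  exact: sumD_lty.
have := integrable_ae measurableT iD; apply: filterS => x /(_ I) xfin.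
pose s n := u n.+1 x - u n x.
have : cvgn [normed series s].
  apply: nondecreasing_is_cvgn.
    by apply: nondecreasing_series => n _ _; exact: normr_ge0.
  exists (fine (\sum_(n <oo) D n x)%E) => _ [n _ <-].
  rewrite -lee_fin fineK// /= /series/= -sumEFin.
  by apply: (@nneseries_lim_ge _ (D ^~ x) xpredT 0%N n) => k _; rewrite lee_fin.
move=> /normed_cvg/cvg_ex[l sl]; exists (u 0%N x + l).
have -> : u ^~ x = (fun n => u 0%N x + series s n).
  apply/funext => n; rewrite /series/= /s telescope_sumr// addrC subrK//.
by apply: cvgD => //; exact: cvg_cst.
Qed.

(** The limit superior is measurable on the whole space and is the limit wherever one exists; [fine]
    replaces infinite values by 0. *)
Let v x := fine (limn_esup (fun n => (u n x)%:E)).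

Let mv : measurable_fun setT v.
Proof.
apply: measurableT_comp => //; apply: measurable_fun_limn_esup => n.
exact/measurable_EFinP.
Qed.

Let ae_cvg_v : {ae P, forall x, u ^~ x @ \oo --> v x}.
Proof.
apply: filterS ae_cvg => x [l ul].
have /cvg_limn_einf_sup[_ e] : (fun n => (u n x)%:E) @ \oo --> l%:E.
  by apply: cvg_EFin => //; exact: nearW.
by rewrite /v e.
Qed.

(** Fatou's lemma for [(u n - u m)^2] as [m] tends to infinity, with the Cauchy estimate of
    [sip_norm_geometric]. *)
Let int_v n : (\int[P]_x ((u n x - v x) ^+ 2)%:E <=
  ((C / (1 - q) * q ^+ n) ^+ 2)%:E)%E.
Proof.
pose f m x := ((u n x - u m x) ^+ 2)%:E.
have mf m : measurable_fun setT (f m).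
  by apply/measurable_EFinP/measurable_funX/measurable_funB.
have f0 m x : setT x -> (0 <= f m x)%E by rewrite lee_fin sqr_ge0.
rewrite (@ge0_ae_eq_integral _ _ _ P setT _ (fun x => limn_einf (f ^~ x)))//.
- have F := fatou P measurableT mf f0; apply: (le_trans F).
  rewrite limn_einf_lim; apply: lime_le; first exact: is_cvg_einfs.
  exists n => // m /= nm.
  apply: (@le_trans _ _ (\int[P]_x f m x)%E).
    by apply: ereal_inf_lbound; exists m => /=.
  have -> : (\int[P]_x f m x)%E = (L2_inner (u n - u m) (u n - u m))%:E.
    by rewrite L2_inner_sqrE.
  rewrite -(sqr_sip_norm sip) lee_fin ler_sqr ?nnegrE ?sip_norm_ge0//.
    exact: (sip_norm_geometric sip q01 C0 uC nm).
  by rewrite mulr_ge0 ?divr_ge0 ?exprn_ge0//; case/andP: q01 => // ? /ltW;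
    rewrite subr_ge0.
- by apply/measurable_EFinP/measurable_funX/measurable_funB.
- have -> : (fun x => limn_einf (f ^~ x)) =
      (fun x => - limn_esup (fun m => - f m x))%E.
    by apply/funext => x; rewrite -limn_einfN; congr limn_einf;
      apply/funext => m; rewrite [RHS]oppeK.
  apply: measurableT_comp => //; apply: measurable_fun_limn_esup => m.
  exact: measurableT_comp.
- by move=> x _; rewrite lee_fin sqr_ge0.
- move=> x _; rewrite limn_einf_lim; apply: lime_ge; first exact: is_cvg_einfs.
  by apply: nearW => m; apply: le_ereal_inf_tmp => _ [k _ <-]; exact: f0.
- apply: filterS ae_cvg_v => x uv _; apply/esym.
  apply: (cvg_limn_einf_sup _).1; apply: cvg_EFin; first exact: nearW.
  rewrite [X in X @ _](_ : _ = (fun m => (u n x - u m x) ^+ 2))//.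
  rewrite expr2; under eq_fun do rewrite expr2.
  by apply: cvgM; apply: cvgB => //; exact: cvg_cst.
Qed.

Lemma L2_geometric_limit :
  exists v : L2, forall n, nrm (u n - v) <= C / (1 - q) * q ^+ n.
Proof.
have B0 n : 0 <= C / (1 - q) * q ^+ n.
  by rewrite mulr_ge0 ?divr_ge0 ?exprn_ge0//; case/andP: q01 => // ? /ltW;
    rewrite subr_ge0.
(* [int_v] shows that [u 0 - v] is square integrable, so the limit is built as [u 0 - (u 0 - v)]. *)
have w2 : (u 0%N : X -> R) \- v \in Lfun P 2%:E.
  apply/Lfun2P; split; first exact: measurable_funB.
  exact: le_lt_trans (int_v 0%N) (ltry _).
pose w : L2 := Lfun_Sub (lee1n 2) w2.
exists (u 0%N - w) => n.
rewrite -(@ler_pXn2r _ 2)// ?nnegrE ?sip_norm_ge0//.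
rewrite (sqr_sip_norm sip) -lee_fin L2_inner_sqrE.
apply: le_trans (int_v n); apply/eq_lee/eq_integral => x _.
congr (_ ^+ 2)%:E.
rewrite -[LHS]/(u n x - (u 0%N x - (u 0%N x - v x))); ring.
Qed.

End sequence.

Lemma L2_geometrically_complete : geometrically_complete (@L2_inner _ X R P).
Proof. by move=> q C u q01 uC; exact: L2_geometric_limit. Qed.

End L2_complete.

(** * Spectral gaps on L2(P) *)

Section spectral_gap_theory.
Context d {X : measurableType d} {R : realType}.
Variable P : probability X R.
Local Notation ip := (@L2_inner _ X R P).
Local Notation nrm := (sip_norm ip).
Local Notation L2 := (L2 P).
Let sip := L2_semi_inner_product P.

Definition L2_one : L2 := Lfun_Sub (lee1n 2) (Lfun_cst P 1 2).

Lemma L2_inner_one : ip L2_one L2_one = 1.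
Proof.
rewrite /L2_inner; under eq_Rintegral do rewrite /= mulr1.
rewrite Rintegral_cst// mul1r; exact: (congr1 fine (probability_setT P)).
Qed.

Lemma L2_inner_onel (f : L2) : ip f L2_one = \int[P]_x f x.
Proof. by apply: eq_Rintegral => x _; rewrite /= mulr1. Qed.

Section lift.
Variables (A : (X -> R) -> X -> R).
Hypothesis AL : forall f, f \in Lfun P 2%:E -> A f \in Lfun P 2%:E.

Definition L2_lift (f : L2) : L2 := Lfun_Sub (lee1n 2) (AL (LfunP f)).

Hypotheses (sA : symmetric_for ip L2_lift) (cA : contractive_for ip L2_lift).
Hypothesis A1 : A (cst 1) = cst 1 %[ae P].

Let resolventE l (f : L2) :
  'N[P]_2%:E[EFin \o (fun x => A f x - l * f x)%R]%E =
  (nrm (L2_lift f - l *: f))%:E.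
Proof. by rewrite -L2_normE. Qed.

Let resolvent_gt1 l : 1 < l -> resolvent P A l.
Proof.
move=> l1; split.
  have [c cb] := bounded_below_gt1 sip cA l1.
  exists c => f fL; pose F : L2 := Lfun_Sub (lee1n 2) fL.
  have := cb F; rewrite -lee_fin EFinM -(resolventE l F) -(L2_normE F); exact.
move=> g gL.
have [f fE] := resolvent_solution sip (symmetric_weakly_linear sip sA) cA
  (@L2_geometrically_complete _ _ _ P) l1 (Lfun_Sub (lee1n 2) gL).
by exists f; [exact: LfunP|move/L2_dist0P : fE].
Qed.

Let resolvent_bounded_below l : resolvent P A l -> bounded_below ip L2_lift l.
Proof.
move=> [[c cb] _]; exists c => f.
rewrite -lee_fin EFinM -(resolventE l f) -(L2_normE f); exact/cb/LfunP.
Qed.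

(** The constant 1 is fixed by [A], hence a nonzero multiple of the eigenfunction [e]; multiples of
    [e] are therefore multiples of 1. *)
Let simple_one : eigenvalue1_simple P A ->
  forall f, nrm (L2_lift f - f) = 0 -> exists c : R, nrm (f - c *: L2_one) = 0.
Proof.
move=> [e [eL e0 Ae eU]] f /L2_dist0P Af.
have [c fc] := eU _ (LfunP f) Af.
have [c1 oc] := eU _ (Lfun_cst P 1 2) A1.
have c10 : c1 != 0.
  apply/eqP => c10.
  have : nrm (L2_one - 0) = 0.
    by apply/L2_dist0P; apply: filterS oc => x /(_ I); rewrite c10 mul0r.
  rewrite subr0 => /(congr1 (fun x => x ^+ 2)).
  by rewrite (sqr_sip_norm sip) L2_inner_one expr0n => /eqP; rewrite oner_eq0.
exists (c / c1); apply/L2_dist0P.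
apply: filterS2 fc oc => x /(_ I) fx /(_ I) ox _.
rewrite fx -[RHS]/(c / c1 * 1) [X in _ = _ / _ * X]ox; field.
exact: c10.
Qed.

(** [gap_coercive] is applied with [a = sup S]: points strictly between the supremum and 1 are
    outside the spectrum, hence regular. *)
Lemma spectral_gap_coercive : 0 < spectral_gap P A ->
  exists2 g : R, 0 < g & forall f : L2, ip f L2_one = 0 ->
    g * ip f f <= ip (f - L2_lift f) f.
Proof.
rewrite /spectral_gap; case: asboolP; last by rewrite ltxx.
move=> /simple_one simple1 gap0.
set S := spectrum P A `\ 1 in gap0.
(* The bound matters: [sup] takes the default value 0 on sets without upper bound. *)
have S1 : ubound S 1.
  by move=> l [Sl _]; rewrite leNgt; apply/negP => /resolvent_gt1.
exists (1 - sup S) => // f f1.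
apply: (gap_coercive sip sA cA _ L2_inner_one simple1
  (@L2_geometrically_complete _ _ _ P)) => //.
- exact/L2_dist0P.
- by rewrite -subr_gt0.
- move=> l /andP[sl l1]; apply: resolvent_bounded_below.
  apply: contrapT => Sl.
  have : l <= sup S.
    apply: ub_le_sup; first by exists 1.
    by split=> //= l1'; move: l1; rewrite l1' ltxx.
  by rewrite leNgt sl.
Qed.

End lift.
End spectral_gap_theory.

(** * Integrals against mixtures of measures *)

Section integral_mixture.
Import HBNNSimple.
Context dX {X : measurableType dX} {R : realType}.

Section approximation.
Context dY {Y : measurableType dY}.
Variables (nu : {measure set Y -> \bar R}) (k : Y -> {measure set X -> \bar R}).
Variable W : Y -> R.
Hypotheses (W0 : forall y, 0 <= W y) (mW : measurable_fun setT W).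
Hypothesis mk : forall U, measurable U -> measurable_fun setT (k ^~ U).
Local Open Scope ereal_scope.

Let mEW : measurable_fun setT (EFin \o W).
Proof. exact/measurable_EFinP. Qed.

Lemma integral_mixture_nnsfun (g : {nnsfun X >-> R}) :
  \int[nu]_y ((W y)%:E * \int[k y]_x (g x)%:E) =
  \sum_(r \in range g) r%:E * \int[nu]_y ((W y)%:E * k y (g @^-1` [set r])).
Proof.
have gE y : \int[k y]_x (g x)%:E =
    \sum_(r \in range g) r%:E * k y (g @^-1` [set r]).
  under eq_integral do rewrite fimfunE -fsumEFin//.
  rewrite ge0_integral_fsum//.
  - apply: eq_fsbigr => r _.
    rewrite (integralZl_indic _ (fun r => g @^-1` [set r]))//; last first.
      by move=> r0; rewrite preimage_nnfun0.
    by rewrite integral_indic// setIT.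
  - by move=> r; exact/measurable_EFinP/measurableT_comp.
  - by move=> r x _; rewrite nnfun_muleindic_ge0.
have rk0 r y : 0 <= r%:E * k y (g @^-1` [set r]).
  have := mulemu_ge0 (fun n => g @^-1` [set n]).
  by apply; exact: preimage_nnfun0.
under eq_integral do rewrite gE ge0_mule_fsumr//.
rewrite ge0_integral_fsum//.
- apply: eq_fsbigr => r _.
  under eq_integral do rewrite muleCA.
  have [r0|r0] := leP 0%R r.
    rewrite ge0_integralZl//.
    - by apply: emeasurable_funM => //; exact: mk.
    - by move=> y _; rewrite mule_ge0// lee_fin.
  rewrite preimage_nnfun0//.
  by rewrite !integral0_eq ?mule0// => y _; rewrite measure0 !mule0.
- by move=> r; apply: emeasurable_funM => //; apply: measurable_funeM; exact: mk.
- by move=> r y _; rewrite mule_ge0// lee_fin.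
Qed.

(** Monotone convergence, first under [k y] and then under [nu]. The right-hand side depends on the
    mixture only through its values on measurable sets. *)
Lemma integral_mixture_approx (f : X -> \bar R)
    (f0 : forall x, 0 <= f x) (mf : measurable_fun setT f) :
  \int[nu]_y ((W y)%:E * \int[k y]_x f x) =
  limn (fun n => let g := nnsfun_approx measurableT mf n in
    \sum_(r \in range g) r%:E * \int[nu]_y ((W y)%:E * k y (g @^-1` [set r]))).
Proof.
pose g := nnsfun_approx measurableT mf.
have gk y : (fun n => \int[k y]_x (g n x)%:E) @ \oo --> \int[k y]_x f x.
  under [X in _ --> X]eq_integral => x _ do
    rewrite -(cvg_lim _ (cvg_nnsfun_approx measurableT mf (fun x _ => f0 x)
      (I : setT x)))//.
  apply: cvg_monotone_convergence => //.
  - by move=> n; exact/measurable_EFinP.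
  - by move=> n x _; rewrite lee_fin.
  - by move=> x _ a b ab; rewrite lee_fin; exact/lefP/nd_nnsfun_approx.
transitivity (\int[nu]_y limn (fun n => (W y)%:E * \int[k y]_x (g n x)%:E)).
  apply: eq_integral => y _; apply/esym/cvg_lim => //.
  exact: cvgeZl.
rewrite monotone_convergence//.
- by congr (limn _); apply/funext => n; rewrite integral_mixture_nnsfun.
- move=> n; apply: emeasurable_funM => //.
  apply: measurable_fun_integral_kernel => //.
    by move=> x; rewrite lee_fin.
  exact/measurable_EFinP.
- move=> n y _; rewrite mule_ge0 ?lee_fin// integral_ge0// => x _.
  by rewrite lee_fin.
- move=> y _ a b ab; rewrite lee_wpmul2l ?lee_fin//.
  apply: ge0_le_integral => //.
  + by move=> x _; rewrite lee_fin.
  + exact/measurable_EFinP.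
  + exact/measurable_EFinP.
  + by move=> x _; rewrite lee_fin; exact/lefP/nd_nnsfun_approx.
Qed.

End approximation.

Local Open Scope ereal_scope.

(** Extends identities from sets to nonnegative functions. Invariance, densities and joint laws are
    all instances, often with Dirac masses as kernels. *)
Lemma eq_integral_mixture d1 (Y1 : measurableType d1) d2 (Y2 : measurableType d2)
    (nu1 : {measure set Y1 -> \bar R}) (nu2 : {measure set Y2 -> \bar R})
    (k1 : Y1 -> {measure set X -> \bar R}) (k2 : Y2 -> {measure set X -> \bar R})
    (W1 : Y1 -> R) (W2 : Y2 -> R) :
  (forall y, 0 <= W1 y)%R -> measurable_fun setT W1 ->
  (forall U, measurable U -> measurable_fun setT (k1 ^~ U)) ->
  (forall y, 0 <= W2 y)%R -> measurable_fun setT W2 ->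
  (forall U, measurable U -> measurable_fun setT (k2 ^~ U)) ->
  (forall B, measurable B -> \int[nu1]_y ((W1 y)%:E * k1 y B) =
                             \int[nu2]_y ((W2 y)%:E * k2 y B)) ->
  forall f, (forall x, 0 <= f x) -> measurable_fun setT f ->
  \int[nu1]_y ((W1 y)%:E * \int[k1 y]_x f x) =
  \int[nu2]_y ((W2 y)%:E * \int[k2 y]_x f x).
Proof.
move=> W10 mW1 mk1 W20 mW2 mk2 k12 f f0 mf.
rewrite (integral_mixture_approx nu1 W10 mW1 mk1 f0 mf).
rewrite (integral_mixture_approx nu2 W20 mW2 mk2 f0 mf).
congr (limn _); apply/funext => n; apply: eq_fsbigr => r _.
by rewrite k12.
Qed.

End integral_mixture.

Section integral_mixture_pair.
Context dX {X : measurableType dX} dX' {X' : measurableType dX'} {R : realType}.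
Context d1 {Y1 : measurableType d1} d2 {Y2 : measurableType d2}.
Variables (nu1 : {measure set Y1 -> \bar R}) (nu2 : {measure set Y2 -> \bar R}).
Variables (k1 : Y1 -> {measure set X -> \bar R}) (k2 : Y2 -> {measure set X -> \bar R}).
Variables (U1 : Y1 -> X') (U2 : Y2 -> X').
Hypotheses (mU1 : measurable_fun setT U1) (mU2 : measurable_fun setT U2).
Hypothesis mk1 : forall B, measurable B -> measurable_fun setT (k1 ^~ B).
Hypothesis mk2 : forall B, measurable B -> measurable_fun setT (k2 ^~ B).
Hypothesis fk1 : forall y B, measurable B -> k1 y B \is a fin_num.
Hypothesis fk2 : forall y B, measurable B -> k2 y B \is a fin_num.
Local Open Scope ereal_scope.

(** The hypothesis is agreement on rectangles. [eq_integral_mixture] is used twice: in [g] with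
    weights [f (U y)], and, for a fixed set [B] in place of [g], in [f] with weights [k y B]. *)
Lemma eq_integral_mixture_pair :
  (forall A B, measurable A -> measurable B ->
    \int[nu1]_y (k1 y B * \d_(U1 y) A) = \int[nu2]_y (k2 y B * \d_(U2 y) A)) ->
  forall (f : X' -> R) (g : X -> \bar R),
    (forall x, 0 <= f x)%R -> measurable_fun setT f ->
    (forall x, 0 <= g x) -> measurable_fun setT g ->
  \int[nu1]_y ((f (U1 y))%:E * \int[k1 y]_x g x) =
  \int[nu2]_y ((f (U2 y))%:E * \int[k2 y]_x g x).
Proof.
move=> k12 f g f0 mf g0 mg.
apply: eq_integral_mixture => //; try exact: measurableT_comp.
move=> B mB.
have : \int[nu1]_y ((fine (k1 y B))%:E * \int[\d_(U1 y)]_x (f x)%:E) =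
       \int[nu2]_y ((fine (k2 y B))%:E * \int[\d_(U2 y)]_x (f x)%:E).
  apply: (@eq_integral_mixture _ X' R _ _ _ _ nu1 nu2 (fun y => \d_(U1 y))
    (fun y => \d_(U2 y)) (fun y => fine (k1 y B)) (fun y => fine (k2 y B))) => //.
  - by apply: measurableT_comp => //; exact: mk1.
  - by move=> A mA; exact: (measurable_kernel (kdirac mU1)).
  - by apply: measurableT_comp => //; exact: mk2.
  - by move=> A mA; exact: (measurable_kernel (kdirac mU2)).
  - move=> A mA.
    under eq_integral do rewrite fineK ?fk1//.
    under [RHS]eq_integral do rewrite fineK ?fk2//.
    exact: k12.
  - exact/measurable_EFinP.
have E d (Y : measurableType d) (nu : {measure set Y -> \bar R})
    (k : Y -> {measure set X -> \bar R}) (U : Y -> X') :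
    (forall y B, measurable B -> k y B \is a fin_num) ->
    \int[nu]_y ((fine (k y B))%:E * \int[\d_(U y)]_x (f x)%:E) =
    \int[nu]_y ((f (U y))%:E * k y B).
  move=> fk; apply: eq_integral => y _; rewrite fineK ?fk//.
  by rewrite integral_dirac ?diracT ?mul1e 1?muleC//; exact/measurable_EFinP.
by rewrite !E.
Qed.

End integral_mixture_pair.

(** * Transition operators on L2(P) *)

Section abs_le_norm2.
Context d {X : measurableType d} {R : realType}.
Variable Q : {measure set X -> \bar R}.
Hypothesis Q1 : Q setT = 1%E.

(** Jensen's inequality for the square; when [f] is not square integrable the right-hand side is
    infinite. *)
Lemma sqr_Rintegral_le (f : X -> R) : measurable_fun setT f ->
  (((\int[Q]_x f x) ^+ 2)%:E <= \int[Q]_x (f x ^+ 2)%:E)%E.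
Proof.
move=> mf.
have [->|f2] := eqVneq (\int[Q]_x (f x ^+ 2)%:E)%E +oo%E; first exact: leey.
have fL : f \in Lfun Q 2%:E by apply/Lfun2P; split => //; rewrite ltey.
have fQ : Q setT \is a fin_num by rewrite Q1.
have f1 : Q.-integrable setT (EFin \o f).
  exact/Lfun1_integrable/(Lfun_subset12 fQ).
have := integral_abs_le_Lnorm2 Q1 mf; rewrite Lnorm2E// => H.
have H1 : `|\int[Q]_x f x| <= Num.sqrt (\int[Q]_x (f x * f x)).
  apply: (le_trans (le_normr_Rintegral measurableT f1)).
  rewrite -lee_fin; apply: le_trans H.
  by rewrite fineK//; exact/integrable_fin_num/(integrable_norm f1).
have i0 : 0 <= \int[Q]_x (f x * f x).
  by apply: Rintegral_ge0 => x _; rewrite -expr2 sqr_ge0.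
have -> : (\int[Q]_x (f x ^+ 2)%:E = (\int[Q]_x (f x * f x))%:E)%E.
  rewrite fineK; last exact/integrable_fin_num/(Lfun2_mulr_integrable fL fL).
  by apply: eq_integral => x _; rewrite expr2.
rewrite lee_fin -(sqr_sqrtr i0) -real_normK ?num_real//.
by rewrite ler_sqr ?nnegrE ?sqrtr_ge0.
Qed.

End abs_le_norm2.

Section transition.
Context dX {X : measurableType dX} {R : realType}.
Variables (P : probability X R) (T : R.-pker X ~> X).

Lemma measurable_transition_operator f : measurable_fun setT f ->
  measurable_fun setT (transition_operator T f).
Proof.
move=> mf; apply: measurableT_comp => //.
under eq_fun do rewrite integralE.
apply: emeasurable_funB; apply: measurable_fun_integral_kernel => //;
  try exact: (measurable_kernel T).
- exact/measurable_funepos/measurable_EFinP.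
- exact/measurable_funeneg/measurable_EFinP.
Qed.

Hypothesis invT : invariant_distribution P T.

Lemma ge0_integral_invariant (F : X -> \bar R) : (forall x, (0 <= F x)%E) ->
  measurable_fun setT F -> (\int[P]_x \int[T x]_y F y = \int[P]_x F x)%E.
Proof.
move=> F0 mF.
transitivity (\int[P]_x ((cst 1 x)%:E * \int[T x]_y F y))%E.
  by apply: eq_integral => x _; rewrite mul1e.
rewrite (@eq_integral_mixture _ X R _ _ _ _ P P T (fun x => \d_x)
  (cst 1) (cst 1))//.
- by apply: eq_integral => x _; rewrite mul1e integral_dirac// diracT mul1e.
- exact: (measurable_kernel T).
- by move=> B mB; exact: (measurable_kernel (kdirac (@measurable_id _ X setT))).
- move=> B mB; under eq_integral do rewrite mul1e.
  rewrite invT//; under eq_integral do rewrite mul1e.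
  by rewrite integral_indic// setIT.
Qed.

(** Jensen's inequality under each [T x], followed by invariance of [P]. *)
Lemma transition_operator_sqr_le f : measurable_fun setT f ->
  (\int[P]_x (transition_operator T f x ^+ 2)%:E <= \int[P]_x (f x ^+ 2)%:E)%E.
Proof.
move=> mf; rewrite -[leRHS]ge0_integral_invariant//; last 2 first.
- by move=> x; rewrite lee_fin sqr_ge0.
- by apply/measurable_EFinP/measurable_funX.
apply: ge0_le_integral => //.
- by move=> x _; rewrite lee_fin sqr_ge0.
- by apply/measurable_EFinP/measurable_funX/measurable_transition_operator.
- apply: measurable_fun_integral_kernel; first exact: (measurable_kernel T).
    by move=> x; rewrite lee_fin sqr_ge0.
  by apply/measurable_EFinP/measurable_funX.
- by move=> x _; exact: (sqr_Rintegral_le (prob_kernel x)).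
Qed.

Lemma transition_operator_Lfun2 f : f \in Lfun P 2%:E ->
  transition_operator T f \in Lfun P 2%:E.
Proof.
move=> /Lfun2P[mf f2]; apply/Lfun2P; split.
  exact: measurable_transition_operator.
exact: le_lt_trans (transition_operator_sqr_le mf) f2.
Qed.

(** By invariance, the mean of [\int[T x] |f|] is that of [|f|], which is finite. Linearity of
    [transition_operator] is available only at such points [x]. *)
Lemma ae_integrable_transition f : f \in Lfun P 2%:E ->
  {ae P, forall x, (T x).-integrable setT (EFin \o f)}.
Proof.
move=> fL; have mf := Lfun2_measurable fL.
have fin1 : P setT \is a fin_num by rewrite probability_setT.
have /Lfun1_integrable f1 : f \in Lfun P 1 by exact: (Lfun_subset12 fin1).
have mabs : measurable_fun setT (fun x => `|f x|%:E).
  by apply/measurable_EFinP; exact: measurableT_comp.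
have : P.-integrable setT (fun x => \int[T x]_y `|f y|%:E)%E.
  apply/integrableP; split.
    apply: measurable_fun_integral_kernel => //; exact: (measurable_kernel T).
  rewrite (eq_integral (fun x => \int[T x]_y `|f y|%:E)%E); last first.
    by move=> x _; rewrite gee0_abs// integral_ge0.
  rewrite ge0_integral_invariant//.
  by have /integrableP[] := f1.
move=> /(integrable_ae measurableT); apply: filterS => x /(_ I) xfin.
apply/integrableP; split; first exact/measurable_EFinP.
by rewrite ltey_eq xfin.
Qed.

End transition.

(** * Correlations of samples *)

Section stationary_process.
Context dX {X : measurableType dX} dO {Omega : measurableType dO} {R : realType}.
Variables (Pr : probability Omega R) (P : probability X R) (T : R.-pker X ~> X).
Variable Z : nat -> {RV Pr >-> X}.

(* Common to Markov chains and, with T x := P, to i.i.d. samples. *)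
Definition transition_law := forall i j (A B : set X), (i <= j)%N ->
  measurable A -> measurable B ->
  Pr (Z i @^-1` A `&` Z j.+1 @^-1` B) =
  (\int[Pr]_w (T (Z j w) B * \d_(Z i w) A))%E.

Hypotheses (idZ : identically_distributed P Z) (lawZ : transition_law).

Lemma ge0_integral_identically_distributed k (F : X -> \bar R) :
  (forall x, (0 <= F x)%E) -> measurable_fun setT F ->
  (\int[Pr]_w F (Z k w) = \int[P]_x F x)%E.
Proof.
move=> F0 mF.
have := @ge0_integral_pushforward _ _ _ _ _ (Z k) (measurable_funPT _) Pr setT F
  measurableT mF (fun x _ => F0 x).
rewrite preimage_setT => <-.
by apply: eq_measure_integral => A mA _; exact: idZ.
Qed.

Lemma transition_law_invariant : invariant_distribution P T.
Proof.
move=> B mB.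
rewrite -(ge0_integral_identically_distributed 0 (F := T ^~ B))//;
  last exact: (measurable_kernel T).
rewrite -(idZ 1%N mB).
have := lawZ (leqnn 0%N) measurableT mB; rewrite preimage_setT setTI => ->.
by apply: eq_integral => w _; rewrite diracT mule1.
Qed.

Lemma Lfun2_sample k f : f \in Lfun P 2%:E -> f \o Z k \in Lfun Pr 2%:E.
Proof.
move=> /Lfun2P[mf f2]; apply/Lfun2P; split; first exact: measurableT_comp.
rewrite (ge0_integral_identically_distributed k (F := fun x => (f x ^+ 2)%:E))//.
- by move=> x; rewrite lee_fin sqr_ge0.
- by apply/measurable_EFinP/measurable_funX.
Qed.

Local Notation ip := (@L2_inner _ X R P).
Local Notation ip' := (@L2_inner _ Omega R Pr).
Local Notation nrm := (sip_norm ip).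
Local Notation nrm' := (sip_norm ip').
Let sip := L2_semi_inner_product P.
Let sip' := L2_semi_inner_product Pr.

Definition L2_sample k (f : L2 P) : L2 Pr :=
  Lfun_Sub (lee1n 2) (Lfun2_sample k (LfunP f)).

Let TL := transition_operator_Lfun2 transition_law_invariant.
Local Notation Top := (L2_lift TL).

Lemma L2_sampleB k f g : L2_sample k (f - g) = L2_sample k f - L2_sample k g.
Proof. by apply/LfuneqP => w. Qed.

Lemma L2_sample_norm k f : ip' (L2_sample k f) (L2_sample k f) = ip f f.
Proof.
apply: EFin_inj; rewrite !L2_inner_sqrE.
rewrite -(ge0_integral_identically_distributed k (F := fun x => (f x ^+ 2)%:E))//.
- by move=> x; rewrite lee_fin sqr_ge0.
- by apply/measurable_EFinP/measurable_funX/Lfun2_measurable/LfunP.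
Qed.

(** Polarisation of [L2_sample_norm]. *)
Lemma L2_sample_inner k f g : ip' (L2_sample k f) (L2_sample k g) = ip f g.
Proof.
have := L2_sample_norm k (f - g); rewrite L2_sampleB.
rewrite !(sipDl sip', ipDr sip', ipNl sip', ipNr sip').
rewrite !(sipDl sip, ipDr sip, ipNl sip, ipNr sip) !L2_sample_norm.
rewrite (sipC sip' (L2_sample k g)) (sipC sip g); lra.
Qed.

Let integral_dirac_samples i j (A B : set X) : measurable A -> measurable B ->
  (\int[Pr]_w (\d_(Z j w) B * \d_(Z i w) A) =
   Pr (Z i @^-1` A `&` Z j @^-1` B))%E.
Proof.
move=> mA mB.
have mAB : measurable (Z i @^-1` A `&` Z j @^-1` B).
  by apply: measurableI; rewrite -[_ @^-1` _]setTI; exact: measurable_funPT.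
rewrite -[X in _ = Pr X]setIT -integral_indic//.
apply: eq_integral => w _.
by rewrite /dirac !indicE in_setI -EFinM -natrM mulnb andbC.
Qed.

Let L2_sample_innerE i j (f g : L2 P) :
  ((ip' (L2_sample i f) (L2_sample j g))%:E =
   \int[Pr]_w ((f (Z i w))%:E * \int[\d_(Z j w)]_x (g x)%:E))%E.
Proof.
have mg : measurable_fun setT g by exact/Lfun2_measurable/LfunP.
rewrite /L2_inner fineK; last exact/integrable_fin_num/L2_inner_integrable.
apply: eq_integral => w _; rewrite EFinM integral_dirac ?diracT ?mul1e//.
exact/measurable_EFinP.
Qed.

(** [lawZ] describes the joint law of [Z i] and [Z j.+1] on rectangles, and
    [eq_integral_mixture_pair] extends it to nonnegative functions. The null set where [g] is not
    integrable under [T x] is pulled back by [Z j], which has law [P]. *)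
Let transition_inner_ge0 i j (f g : L2 P) : (i <= j)%N ->
  (forall x, 0 <= f x) -> (forall x, 0 <= g x) ->
  ip' (L2_sample i f) (L2_sample j.+1 g) = ip' (L2_sample i f) (L2_sample j (Top g)).
Proof.
move=> ij f0 g0; apply: EFin_inj.
have mf : measurable_fun setT f by exact/Lfun2_measurable/LfunP.
have mg : measurable_fun setT g by exact/Lfun2_measurable/LfunP.
rewrite L2_sample_innerE [RHS]fineK; last first.
  exact/integrable_fin_num/L2_inner_integrable.
rewrite (@eq_integral_mixture_pair _ _ _ _ R _ _ _ _ Pr Pr
  (fun w => \d_(Z j.+1 w)) (fun w => T (Z j w)) (Z i) (Z i))//.
- have mT : measurable_fun setT (Top g) by exact/Lfun2_measurable/LfunP.
  apply: ge0_ae_eq_integral => //.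
  + apply: emeasurable_funM; first exact/measurable_EFinP/measurableT_comp.
    apply: (measurable_fun_integral_kernel (l := fun w => T (Z j w))) => //.
    * move=> U mU; exact: (measurableT_comp (measurable_kernel T U mU)).
    * exact/measurable_EFinP.
  + apply/measurable_EFinP; apply: measurable_funM; exact: measurableT_comp.
  + by move=> w _; apply: mule_ge0; [|apply: integral_ge0 => x _]; rewrite lee_fin.
  + move=> w _; rewrite lee_fin; apply: mulr_ge0; first exact: f0.
    by apply: Rintegral_ge0 => x _; exact: g0.
  + have := ae_integrable_transition transition_law_invariant (LfunP g).
    move=> [N [mN N0 subN]]; exists (Z j @^-1` N); split.
    * by rewrite -[_ @^-1` _]setTI; exact: measurable_funPT.
    * exact: etrans (idZ j mN) N0.
    * move=> w /= wN; apply: subN => /= gi; apply: wN => _.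
      by rewrite EFinM /= /transition_operator fineK//; exact/integrable_fin_num.
- by move=> B mB; exact: (measurable_kernel (kdirac (measurable_funPT (Z j.+1)))).
- by move=> B mB; exact: (measurableT_comp (measurable_kernel T B mB)).
- by move=> w B mB; exact: finite_kernel_measure.
- by move=> A B mA mB; rewrite -lawZ//; exact: integral_dirac_samples.
- exact/measurable_EFinP.
Qed.

Let L2_pos (f : L2 P) : f^\+ \in Lfun P 2%:E.
Proof.
have /Lfun2P[mf f2] := LfunP f; apply/Lfun2P; split; first exact: measurable_funrpos.
apply: le_lt_trans f2; apply: ge0_le_integral => //.
- by move=> x _; rewrite lee_fin sqr_ge0.
- by apply/measurable_EFinP/measurable_funX/measurable_funrpos.
- by apply/measurable_EFinP/measurable_funX.
- move=> x _; rewrite lee_fin /funrpos; case: (leP 0 (f x)) => //= _.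
  by rewrite expr0n sqr_ge0.
Qed.

Let L2_posneg (f : L2 P) : exists fp fn : L2 P,
  [/\ f = fp - fn, forall x, 0 <= fp x & forall x, 0 <= fn x].
Proof.
exists (Lfun_Sub (lee1n 2) (L2_pos f)), (Lfun_Sub (lee1n 2) (L2_pos (- f))).
split; last 2 first.
- by move=> x; rewrite /= /funrpos le_max lexx orbT.
- by move=> x; rewrite /= /funrpos le_max lexx orbT.
apply/LfuneqP => x.
rewrite -[RHS]/(Num.max (f x) 0 - Num.max (- f x) 0).
by case: (leP 0 (f x)) => h; case: (leP 0 (- f x)) => h'; lra.
Qed.

Let TopB f g : nrm (Top (f - g) - (Top f - Top g)) = 0.
Proof.
apply/L2_dist0P.
have fi := ae_integrable_transition transition_law_invariant (LfunP f).
have gi := ae_integrable_transition transition_law_invariant (LfunP g).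
apply: filterS2 fi gi => x fi gi _.
by rewrite -[RHS]/(\int[T x]_y f y - \int[T x]_y g y) -RintegralB.
Qed.

Let L2_sample_TopB f g j h :
  ip' h (L2_sample j (Top (f - g))) =
  ip' h (L2_sample j (Top f)) - ip' h (L2_sample j (Top g)).
Proof.
apply/eqP; rewrite -subr_eq0; apply/eqP.
have E : nrm' (L2_sample j (Top (f - g) - (Top f - Top g))) = 0.
  by rewrite /sip_norm L2_sample_norm; exact: TopB.
have := sip_norm0_ip sip' h E.
by rewrite !L2_sampleB (sipC sip') !(ipDr sip', ipNr sip'); lra.
Qed.

Lemma L2_sample_transition i j (f g : L2 P) : (i <= j)%N ->
  ip' (L2_sample i f) (L2_sample j.+1 g) = ip' (L2_sample i f) (L2_sample j (Top g)).
Proof.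
move=> ij.
have [fp [fn [-> fp0 fn0]]] := L2_posneg f.
have [gp [gn [-> gp0 gn0]]] := L2_posneg g.
rewrite L2_sample_TopB !L2_sampleB !(sipDl sip', ipDr sip', ipNl sip', ipNr sip').
by rewrite !transition_inner_ge0//; lra.
Qed.

(** Each of the [k] transitions is absorbed into [g], the last one first. This is the correlation
    hypothesis of [stationary_sum_le]. *)
Lemma L2_sample_iter i k (f g : L2 P) :
  ip' (L2_sample i f) (L2_sample (i + k) g) = ip f (iter k Top g).
Proof.
elim: k g => [|k IH] g; first by rewrite addn0 L2_sample_inner.
by rewrite addnS L2_sample_transition ?leq_addr// IH iterSr.
Qed.

(** Inner products with [Top g] become correlations of [Z 0] and [Z 1], where linearity of
    [L2_sample] holds pointwise. *)
Let ip_Top f g : ip f (Top g) = ip' (L2_sample 0 f) (L2_sample 1 g).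
Proof. by rewrite (L2_sample_iter 0 1). Qed.

Lemma transition_weakly_linear : weakly_linear ip Top.
Proof.
move=> a f g h; rewrite 3!(sipC sip _ h) !ip_Top.
have -> : L2_sample 1 (a *: f + g) = a *: L2_sample 1 f + L2_sample 1 g.
  by apply/LfuneqP.
by rewrite (ipDr sip') (ipZr sip').
Qed.

Lemma transition_contractive : contractive_for ip Top.
Proof.
move=> f; rewrite -lee_fin !L2_inner_sqrE.
apply: transition_operator_sqr_le; first exact: transition_law_invariant.
exact/Lfun2_measurable/LfunP.
Qed.

Lemma transition_inner_one f : ip (Top f) (L2_one P) = ip f (L2_one P).
Proof.
rewrite !(sipC sip _ (L2_one P)) ip_Top -(L2_sample_inner 1).
by congr (ip' _ _); apply/LfuneqP.
Qed.

Section reversible.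
Hypothesis revT : reversible P T.

(** Reversibility means that the pair of [Z 0] and [Z 1] is exchangeable. *)
Let law_swap (A B : set X) : measurable A -> measurable B ->
  Pr (Z 0 @^-1` A `&` Z 1 @^-1` B) = Pr (Z 0 @^-1` B `&` Z 1 @^-1` A).
Proof.
move=> mA mB; rewrite !lawZ//.
have E (C D : set X) : measurable C -> measurable D ->
    (\int[Pr]_w (T (Z 0 w) D * \d_(Z 0 w) C) = \int[P]_(x in C) T x D)%E.
  move=> mC mD.
  rewrite (ge0_integral_identically_distributed 0
    (F := fun x => T x D * \d_x C)%E).
  - rewrite [RHS]integral_mkcond; apply: eq_integral => x _.
    by rewrite patchE diracE; case: ifPn => _; rewrite ?mule1 ?mule0.
  - by move=> x; rewrite mule_ge0.
  - apply: emeasurable_funM; first exact: (measurable_kernel T).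
    exact: (measurable_kernel (kdirac (@measurable_id _ X setT))).
by rewrite !E// revT.
Qed.

Let swap_inner_ge0 (f g : L2 P) :
  (forall x, 0 <= f x) -> (forall x, 0 <= g x) ->
  ip' (L2_sample 0 f) (L2_sample 1 g) = ip' (L2_sample 1 f) (L2_sample 0 g).
Proof.
move=> f0 g0; apply: EFin_inj.
have mf : measurable_fun setT f by exact/Lfun2_measurable/LfunP.
have mg : measurable_fun setT g by exact/Lfun2_measurable/LfunP.
rewrite !L2_sample_innerE; apply: (@eq_integral_mixture_pair _ _ _ _ R _ _ _ _ Pr Pr
  (fun w => \d_(Z 1 w)) (fun w => \d_(Z 0 w)) (Z 0) (Z 1)) => //.
- by move=> B mB; exact: (measurable_kernel (kdirac (measurable_funPT (Z 1)))).
- by move=> B mB; exact: (measurable_kernel (kdirac (measurable_funPT (Z 0)))).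
- by move=> A B mA mB; rewrite !integral_dirac_samples// law_swap// setIC.
- exact/measurable_EFinP.
Qed.

Lemma transition_symmetric : symmetric_for ip Top.
Proof.
move=> f g; rewrite (sipC sip) !ip_Top (sipC sip').
have [fp [fn [-> fp0 fn0]]] := L2_posneg f.
have [gp [gn [-> gp0 gn0]]] := L2_posneg g.
rewrite !L2_sampleB !(sipDl sip', ipDr sip', ipNl sip', ipNr sip').
by rewrite !swap_inner_ge0//; lra.
Qed.

End reversible.

Lemma sample_sum_le c (f : L2 P) n : 0 <= c -> poisson_bound ip Top (L2_one P) c ->
  ip f (L2_one P) = 0 ->
  ip' (\sum_(i < n) L2_sample i f) (\sum_(i < n) L2_sample i f) <=
  4 * c * n%:R * ip f f.
Proof.
move=> c0 pc f1.
have pc' := stationary_sum_le sip transition_weakly_linear transition_contractive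
  transition_inner_one c0 pc sip' f1.
exact: (pc' (fun i => L2_sample i f) (fun i k => L2_sample_iter i k f f)).
Qed.

End stationary_process.

(** * Poisson bounds from spectral and pseudo spectral gaps *)

Section adjoint.
Variables (R : realType) (V : lmodType R) (ip : V -> V -> R).
Hypothesis sip : semi_inner_product ip.
Variables S B : V -> V.
Hypothesis adj : forall f g, ip (S f) g = ip f (B g).

Lemma adjoint_iter k f g : ip (iter k S f) g = ip f (iter k B g).
Proof. by elim: k f => // k IH f; rewrite iterSr IH adj. Qed.

(** [|B g|^2 = <S (B g), g> <= |B g| |g|]. *)
Lemma adjoint_contractive : contractive_for ip S -> contractive_for ip B.
Proof.
move=> cS g; have := ip_le sip (S (B g)) g; rewrite adj.
have nS : sip_norm ip (S (B g)) <= sip_norm ip (B g).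
  exact: sip_norm_contractive.
rewrite -!(sqr_sip_norm sip) => H.
rewrite ler_sqr ?nnegrE ?sip_norm_ge0//.
have [->|Bg0] := eqVneq (sip_norm ip (B g)) 0; first exact: sip_norm_ge0.
have Bgp : 0 < sip_norm ip (B g) by rewrite lt_neqAle eq_sym Bg0 sip_norm_ge0.
rewrite -(ler_pM2l Bgp) -expr2 (le_trans H)// ler_wpM2r// sip_norm_ge0//.
Qed.

End adjoint.

Section sample_poisson_bound.
Context dX {X : measurableType dX} dO {Omega : measurableType dO} {R : realType}.
Variables (Pr : probability Omega R) (P : probability X R) (T : R.-pker X ~> X).
Variable Z : nat -> {RV Pr >-> X}.
Hypotheses (idZ : identically_distributed P Z) (lawZ : transition_law T Z).
Local Notation ip := (@L2_inner _ X R P).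
Let sip := L2_semi_inner_product P.
Let TL := transition_operator_Lfun2 (transition_law_invariant idZ lawZ).
Local Notation Top := (L2_lift TL).
Let cT : contractive_for ip Top := transition_contractive idZ lawZ.
Let lT : weakly_linear ip Top := transition_weakly_linear idZ lawZ.

Lemma transition_operator1 : transition_operator T (cst 1) = cst 1.
Proof.
apply/funext => x; rewrite /transition_operator Rintegral_cst// mul1r.
by rewrite prob_kernel.
Qed.

Lemma has_spectral_gap_poisson_bound : has_spectral_gap P T ->
  exists2 c : R, 0 <= c & poisson_bound ip Top (L2_one P) c.
Proof.
move=> [revT gap0].
have T1 : transition_operator T (cst 1) = cst 1 %[ae P].
  by rewrite transition_operator1; exact: aeW.
have [g g0 co] := spectral_gap_coercive (transition_symmetric idZ lawZ revT) cT T1 gap0.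
exists g^-1; first by rewrite invr_ge0 ltW.
exact: coercive_poisson_bound.
Qed.

(** The operator [A = B^k T^k] satisfies [<A f, g> = <T^k f, T^k g>]. It is thus a symmetric
    contraction, and its coercivity reads [g |w|^2 <= |w|^2 - |T^k w|^2], as
    [iter_coercive_poisson_bound] requires. *)
Lemma has_pseudo_spectral_gap_poisson_bound : has_pseudo_spectral_gap P T ->
  exists2 c : R, 0 <= c & poisson_bound ip Top (L2_one P) c.
Proof.
move=> [B [BL adjB] gap0].
(* A set with a positive supremum has a positive element. *)
have [k k0 gapk] : exists2 k : nat, (0 < k)%N & 0 < spectral_gap P
    (fun f => iter k B (iter k (transition_operator T) f)).
  apply: contrapT => /forall2NP nogap; move: gap0; apply/negP; rewrite -leNgt.
  apply: ge_sup; first by eexists; exists 1%N.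
  move=> _ [k k0 ->]; rewrite ler_pdivrMr ?ltr0n// mul0r leNgt; apply/negP => h.
  by have [|] := nogap k.
pose BL2 := L2_lift BL.
have itT (g : L2 P) : iter k (transition_operator T) g = iter k Top g :> (X -> R).
  by elim: k {k0 gapk} => //= k ->.
have itB (g : L2 P) : iter k B g = iter k BL2 g :> (X -> R).
  by elim: k {k0 gapk itT} => //= k ->.
have AL f : f \in Lfun P 2%:E ->
    iter k B (iter k (transition_operator T) f) \in Lfun P 2%:E.
  move=> fL; rewrite (itT (Lfun_Sub (lee1n 2) fL)) itB; exact: LfunP.
have adj f g : ip (Top f) g = ip f (BL2 g) by exact: adjB (LfunP f) (LfunP g).
have liftE f : L2_lift AL f = iter k BL2 (iter k Top f).
  by apply/LfuneqP => x; rewrite /L2_lift /= itT itB.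
have cB := adjoint_contractive sip adj cT.
have AA f g : ip (L2_lift AL f) g = ip (iter k Top f) (iter k Top g).
  by rewrite (sipC sip) liftE -(adjoint_iter adj) (sipC sip).
have sA : symmetric_for ip (L2_lift AL).
  by move=> f g; rewrite AA (sipC sip f) AA (sipC sip).
have itc (S : L2 P -> L2 P) f : contractive_for ip S ->
    ip (iter k S f) (iter k S f) <= ip f f.
  move=> cS; rewrite -!(sqr_sip_norm sip) ler_sqr ?nnegrE ?sip_norm_ge0//.
  exact: sip_norm_iter.
have cA : contractive_for ip (L2_lift AL).
  by move=> f; rewrite liftE (le_trans (itc _ _ cB))// itc.
have T1 : iter k Top (L2_one P) = L2_one P.
  elim: k {k0 gapk itT itB AL liftE cB AA sA itc cA} => //= k ->.
  by apply/LfuneqP => x; rewrite /= transition_operator1.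
(* [|A 1 - 1|^2 = |A 1|^2 - 2 <A 1, 1> + 1 <= 1 - 2 + 1 = 0], because [<A 1, 1> = |T^k 1|^2 = 1]. *)
have A1 : iter k B (iter k (transition_operator T) (cst 1)) = cst 1 %[ae P].
  apply/(L2_dist0P (L2_lift AL (L2_one P)) (L2_one P)).
  apply/eqP; rewrite sqrtr_eq0.
  have := cA (L2_one P); rewrite !(sipDl sip, ipDr sip, ipNl sip, ipNr sip).
  rewrite (sipC sip (L2_one P) (L2_lift AL _)) (AA _ (L2_one P)) T1 L2_inner_one; lra.
have [g g0 co] := spectral_gap_coercive sA cA A1 gapk.
exists (2 * k%:R / g); first by rewrite divr_ge0 ?mulr_ge0// ltW.
apply: (iter_coercive_poisson_bound sip lT cT g0) => w w1.
by have := co w w1; rewrite (sipDl sip) (ipNl sip) AA.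
Qed.

End sample_poisson_bound.

(** * Mean square error of sample means *)

Section samples_mse.
Context dX {X : measurableType dX} dO {Omega : measurableType dO} {R : realType}.
Variables (Pr : probability Omega R) (P : probability X R).
Variable Z : nat -> {RV Pr >-> X}.

Let mZ i (A : set X) : measurable A -> measurable (Z i @^-1` A).
Proof. by move=> mA; rewrite -[_ @^-1` _]setTI; exact: measurable_funPT. Qed.

Lemma g_sigma_preimage_sample n i (A : set X) : (i <= n)%N -> measurable A ->
  g_sigma_preimage (fun (i : 'I_n.+1) => Z i : Omega -> X) (Z i @^-1` A).
Proof.
move=> ij mA; apply: sub_sigma_algebra => /=; rewrite -bigcup_seq/=.
exists (Ordinal (ij : i < n.+1)%N) => /=; first by rewrite mem_index_enum.
by exists A => //; rewrite setTI.
Qed.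

Lemma markov_chain_transition_law (T : R.-pker X ~> X) :
  markov_chain T Z -> transition_law T Z.
Proof.
move=> mcZ i j A B ij mA mB.
rewrite (mcZ j (Z i @^-1` A) B (g_sigma_preimage_sample ij mA) mB).
rewrite integral_mkcond; apply: eq_integral => w _.
rewrite patchE /dirac indicE.
rewrite (_ : (Z i w \in A) = (w \in Z i @^-1` A)); last by apply/idP/idP; rewrite !inE.
by case: ifPn => _; rewrite ?mule1 ?mule0.
Qed.

Lemma stationary_markov_chain_identically_distributed (T : R.-pker X ~> X) :
  stationary_markov_chain P T Z -> identically_distributed P Z.
Proof.
move=> [invT mcZ Z0]; elim=> [//|n IH] B mB.
have := markov_chain_transition_law mcZ (leqnn n) measurableT mB.
rewrite preimage_setT setTI => ->.
have mT := measurable_kernel T B mB.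
have := @ge0_integral_pushforward _ _ _ _ _ (Z n) (measurable_funPT _) Pr setT (T ^~ B)
  measurableT mT (fun x _ => measure_ge0 (T x) B).
rewrite preimage_setT => H.
transitivity (\int[Pr]_w T (Z n w) B)%E.
  by apply: eq_integral => w _; rewrite diracT mule1.
rewrite -[LHS]H -invT//.
by apply: eq_measure_integral => A mA _; exact: IH.
Qed.

(** For the constant kernel [P], this is independence of [Z i] and [Z j.+1], whose indices differ as
    [i <= j]. *)
Lemma iid_transition_law : iid P Z ->
  transition_law (kprobability (measurable_cst (P : pprobability X R))) Z.
Proof.
move=> [idZ indZ] i j A B ij mA mB.
have ij' : i != j.+1 by rewrite neq_ltn ltnS ij.
transitivity (P B * P A)%E; last first.
  have mD : measurable_fun setT (fun w => \d_(Z i w) A : \bar R).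
    exact: (measurable_kernel (kdirac (measurable_funPT (Z i))) A mA).
  transitivity (P B * \int[Pr]_w \d_(Z i w) A)%E; last first.
    by rewrite -ge0_integralZl.
  congr (_ * _)%E; rewrite -(idZ i)// -[X in Pr X]setIT.
  by rewrite -integral_indic//; exact: mZ.
pose AB k := if k == i then A else B.
have := indZ [fset i; j.+1]%fset AB.
have -> : \bigcap_(k in [set` [fset i; j.+1]%fset]) (Z k @^-1` AB k) =
    Z i @^-1` A `&` Z j.+1 @^-1` B.
  apply/seteqP; split=> w.
    move=> h; split.
      by have := h i; rewrite /AB eqxx; apply; rewrite /= !inE eqxx.
    have := h j.+1; rewrite /AB eq_sym (negbTE ij'); apply.
    by rewrite /= !inE eqxx orbT.
  move=> [hA hB] k /=; rewrite !inE => /orP[] /eqP ->; rewrite /AB ?eqxx//.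
  by rewrite eq_sym (negbTE ij').
have ABi : AB i = A by rewrite /AB eqxx.
have ABj : AB j.+1 = B by rewrite /AB eq_sym (negbTE ij').
rewrite big_fsetU1 ?inE//= big_seq_fset1 ABi ABj !idZ// muleC; apply => k.
by rewrite /AB; case: ifP.
Qed.

Local Notation samples := (iid P Z \/ exists2 T : R.-pker X ~> X,
  stationary_markov_chain P T Z &
  has_spectral_gap P T \/ has_pseudo_spectral_gap P T).

Lemma samples_poisson_bound : samples ->
  exists (T : R.-pker X ~> X) (idZ : identically_distributed P Z)
    (lawZ : transition_law T Z),
  exists2 c : R, 0 <= c & poisson_bound (@L2_inner _ X R P)
    (L2_lift (transition_operator_Lfun2 (transition_law_invariant idZ lawZ)))
    (L2_one P) c.
Proof.
move=> [iidZ|[T mcT gapT]].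
  exists (kprobability (measurable_cst (P : pprobability X R))), iidZ.1.
  exists (iid_transition_law iidZ), 1 => // w w1; rewrite mul1r.
  set Tw := L2_lift _ w.
  (* [Tw] is the constant [E w], which is 0; the estimate holds with constant 1. *)
  have -> : w - Tw = w.
    apply/LfuneqP => x; rewrite -[LHS]/(w x - \int[P]_y w y).
    by rewrite -L2_inner_onel w1 subr0.
  by [].
have [_ mcZ _] := mcT.
exists T, (stationary_markov_chain_identically_distributed mcT).
exists (markov_chain_transition_law mcZ).
case: gapT => ?; first exact: has_spectral_gap_poisson_bound.
exact: has_pseudo_spectral_gap_poisson_bound.
Qed.

Lemma sample_mean_square_error : samples ->
  exists2 C : R, 0 < C & forall f : X -> R, measurable_fun setT f ->
    forall N, (0 < N)%N ->
    (\int[Pr]_w ((N%:R^-1 * (\sum_(k < N) f (Z k w)) - \int[P]_x f x) ^+ 2)%:E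
     <= (C / N%:R)%:E * \int[P]_x (f x ^+ 2)%:E)%E.
Proof.
move=> /samples_poisson_bound[T [idZ [lawZ [c c0 pc]]]].
(* [4 * c] comes from [stationary_sum_le]; adding 1 makes the constant positive, as [c] may be 0. *)
exists (4 * c + 1); first by rewrite ltr_wpDl// mulr_ge0.
move=> f mf N N0.
have NR : 0 < N%:R :> R by rewrite ltr0n.
have C0 : 0 < (4 * c + 1) / N%:R by rewrite divr_gt0// ltr_wpDl// mulr_ge0.
have [->|f2] := eqVneq (\int[P]_x (f x ^+ 2)%:E)%E +oo%E.
  by rewrite gt0_muley ?lte_fin// leey.
have sip := L2_semi_inner_product P.
have fL : f \in Lfun P 2%:E by apply/Lfun2P; split => //; rewrite ltey.
pose F : L2 P := Lfun_Sub (lee1n 2) fL.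
pose m := \int[P]_x f x.
pose G : L2 P := F - m *: L2_one P.
have F1 : L2_inner F (L2_one P) = m by rewrite L2_inner_onel.
have G1 : L2_inner G (L2_one P) = 0.
  by rewrite (sipDl sip) (ipNl sip) (sipZl sip) L2_inner_one F1; lra.
(* Centring does not increase the norm: [|G|^2 = |F|^2 - m^2]. *)
have GG : L2_inner G G <= L2_inner F F.
  rewrite !(sipDl sip, ipDr sip, ipNl sip, ipNr sip, sipZl sip, ipZr sip).
  rewrite (sipC sip (L2_one P)) F1 L2_inner_one.
  by have := sqr_ge0 m; lra.
have := sample_sum_le N c0 pc G1; set S := \sum_(i < N) _ => HS.
have SE w : S w = \sum_(k < N) (f (Z k w) - m).
  rewrite /S; elim: (N) => [|n IH]; first by rewrite !big_ord0.
  rewrite !big_ord_recr/= -IH.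
  by rewrite -[LHS]/((\sum_(i < n) L2_sample idZ i G) w + (f (Z n w) - m * 1)) mulr1.
rewrite -[X in (_ <= _ * X)%E]/(\int[P]_x (F x ^+ 2)%:E)%E -L2_inner_sqrE -EFinM.
have -> : (\int[Pr]_w ((N%:R^-1 * (\sum_(k < N) f (Z k w)) - m) ^+ 2)%:E =
    ((N%:R^-1) ^+ 2 * L2_inner S S)%:E)%E.
  rewrite EFinM L2_inner_sqrE -ge0_integralZl_EFin//.
  - apply: eq_integral => w _; rewrite SE sumrB sumr_const card_ord -EFinM -exprMn.
    congr (_ ^+ 2)%:E; rewrite -[m *+ N]mulr_natl; field.
    by rewrite gt_eqF.
  - by move=> w _; rewrite lee_fin sqr_ge0.
  - by apply/measurable_EFinP/measurable_funX/Lfun2_measurable/LfunP.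
rewrite lee_fin.
apply: (@le_trans _ _ (N%:R^-1 ^+ 2 * (4 * c * N%:R * L2_inner G G))).
  by rewrite ler_wpM2l ?sqr_ge0.
have -> : N%:R^-1 ^+ 2 * (4 * c * N%:R * L2_inner G G) = 4 * c / N%:R * L2_inner G G.
  by field; rewrite gt_eqF.
apply: ler_pM => //.
- by rewrite divr_ge0// ?mulr_ge0// ltW.
- exact: sip_ge0.
- by rewrite ler_pM2r ?invr_gt0//; lra.
Qed.

End samples_mse.

(** * Lebesgue measure on R^d *)

Section affine_line.
Context {R : realType}.
Local Notation leb := (@lebesgue_measure R).

Definition affine_line (a c : R) : measurableTypeR R -> measurableTypeR R :=
  fun x => a + c * x.

Lemma measurable_affine_line a c : measurable_fun setT (affine_line a c).
Proof. by apply: measurable_funD => //; exact: measurable_funM. Qed.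

Section nonzero_slope.
Variables (a c : R).
Hypothesis c0 : c != 0.
Let nc : 0 <= `|c|. Proof. by []. Qed.
(* [pushforward] takes a measurability proof that unification does not find,
   hence the explicit name of its measure instance. *)
Let mu := mscale (NngNum nc)
  (measure_function_pushforward__canonical__measure_function_Measure
    leb (measurable_affine_line a c)).

(** [mu] is [|c|] times the image of Lebesgue measure under [x |-> a + c x]. It suffices to compare
    lengths of intervals []u, v]], whose preimages are closed on the left when [c < 0]. *)
Lemma lebesgue_measure_affine (A : set (measurableTypeR R)) :
  measurable A -> leb A = mu A.
Proof.
move: A; apply: (lebesgue_measure_unique (mu := mu)) => _ [[u v] _ <-].
rewrite -[RHS]/(`|c|%:E * leb (affine_line a c @^-1` _))%E /=.
have [cn|cp|/eqP] := ltgtP c 0; last by rewrite (negbTE c0).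
- have -> : affine_line a c @^-1` `]u, v]%classic = `[(v - a) / c, (u - a) / c[%classic.
    apply/seteqP; split => x /=; rewrite /affine_line !in_itv/= ler_ndivrMr// ltr_ndivlMr//.
      by move=> /andP[h1 h2]; apply/andP; split; lra.
    by move=> /andP[h1 h2]; apply/andP; split; lra.
  rewrite !lebesgue_measure_itv/= !lte_fin ltr_nM2r ?invr_lt0// ltrD2r.
  case: ifP => _; last by rewrite mule0.
  rewrite -!EFinB -EFinM ltr0_norm//; congr _%:E; field; exact: c0.
- have -> : affine_line a c @^-1` `]u, v]%classic = `](u - a) / c, (v - a) / c]%classic.
    apply/seteqP; split => x /=; rewrite /affine_line !in_itv/= ltr_pdivrMr// ler_pdivlMr//.
      by move=> /andP[h1 h2]; apply/andP; split; lra.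
    by move=> /andP[h1 h2]; apply/andP; split; lra.
  rewrite !lebesgue_measure_itv/= !lte_fin ltr_pM2r ?invr_gt0// ltrD2r.
  case: ifP => _; last by rewrite mule0.
  rewrite -!EFinB -EFinM gtr0_norm//; congr _%:E; field; exact: c0.
Qed.

Lemma ge0_integral_affine_line (F : R -> \bar R) :
  (forall x, 0 <= F x)%E -> measurable_fun setT F ->
  (\int[leb]_x F x = `|c|%:E * \int[leb]_x F (a + c * x)%R)%E.
Proof.
move=> F0 mF.
transitivity (\int[mu]_x F x)%E.
  by apply: eq_measure_integral => A mA _; exact: lebesgue_measure_affine.
rewrite ge0_integral_mscale//; congr (_ * _)%E.
have := @ge0_integral_pushforward _ _ _ _ _ (affine_line a c)
  (measurable_affine_line a c) leb setT F measurableT mF (fun x _ => F0 x).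
by rewrite preimage_setT.
Qed.

End nonzero_slope.
End affine_line.

Section affine_rV.
Context {R : realType}.
Local Notation leb d := (lebesgue_rV d : {measure set 'rV[R]_d -> \bar R}).

Lemma measurable_affine_rV d (a : 'rV[R]_d) (c : R) :
  measurable_fun setT (fun x : 'rV[R]_d => a + c *: x).
Proof.
apply/measurable_fun_rVP => i; under eq_fun do rewrite !mxE.
by apply: measurable_funD => //; apply: measurable_funM => //; exact: measurable_rV_coord.
Qed.

Lemma ge0_integral_rVS d (F : 'rV[R]_d.+1 -> \bar R) :
  (forall x, 0 <= F x)%E -> measurable_fun setT F ->
  (\int[leb d.+1]_x F x = \int[lebesgue_measure]_x \int[leb d]_w F (cons_rV (x, w)))%E.
Proof.
move=> F0 mF.
have := @ge0_integral_pushforward _ _ _ _ _ (@cons_rV R d) (measurable_funPT _)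
  (lebesgue_measure \x leb d)%E setT F measurableT mF (fun x _ => F0 x).
rewrite preimage_setT => H; rewrite [LHS]H fubini_tonelli1//.
- exact: measurableT_comp.
- by move=> x; exact: F0.
Qed.

(** Induction on the dimension by Tonelli: the one-dimensional formula handles the first coordinate
    and contributes one factor [|c|]. *)
Lemma ge0_integral_affine_rV d (a : 'rV[R]_d) (c : R) (F : 'rV[R]_d -> \bar R) :
  c != 0 -> (forall x, 0 <= F x)%E -> measurable_fun setT F ->
  (\int[leb d]_x F x = (`|c| ^+ d)%:E * \int[leb d]_x F (a + c *: x)%R)%E.
Proof.
move=> c0; elim: d a F => [|d IH] a F F0 mF.
  rewrite mul1e; apply: eq_integral => x _; congr F; apply/rowP; by case.
have mFa : measurable_fun setT (fun x : 'rV[R]_d.+1 => F (a + c *: x)).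
  exact: measurableT_comp mF (measurable_affine_rV a c).
rewrite !ge0_integral_rVS//.
have mFc : measurable_fun setT (fun z : measurableTypeR R * 'rV[R]_d => F (cons_rV z)).
  exact: measurableT_comp.
have mFac : measurable_fun setT
    (fun z : measurableTypeR R * 'rV[R]_d => F (a + c *: cons_rV z)).
  exact: (measurableT_comp mFa (@measurable_cons_rV R d)).
have mi : measurable_fun setT (fun x => \int[leb d]_w F (cons_rV (x, w)))%E.
  exact: (measurable_fun_fubini_tonelli_F (fun z => F (cons_rV z))).
rewrite (ge0_integral_affine_line (a 0 ord0) c0)//; last first.
  by move=> x; exact: integral_ge0.
rewrite exprS EFinM -muleA; congr (_ * _)%E.
rewrite -ge0_integralZl//.
- apply: eq_integral => x _.
  rewrite (IH (uncons_rV a).2)//.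
  + congr (_ * _)%E; apply: eq_integral => w _; congr F.
    apply/rowP => i; rewrite !mxE; case: unliftP => [j ->|->] //=.
    by rewrite !mxE.
  + exact: (measurableT_comp mFc (pair1_measurable _)).
- exact: (measurable_fun_fubini_tonelli_F (fun z => F (a + c *: cons_rV z))).
- by move=> x _; exact: integral_ge0.
Qed.

End affine_rV.

Section integral_density.
Context {R : realType} {d : nat}.
Local Notation V := 'rV[R]_d.

(** Both sides are mixtures of Dirac masses, with weight 1 under [P] and weight [p] under Lebesgue
    measure. *)
Lemma ge0_integral_has_density (P : probability V R) (p : V -> R) (F : V -> \bar R) :
  has_density P p -> (forall x, 0 <= p x) -> measurable_fun setT p ->
  (forall x, 0 <= F x)%E -> measurable_fun setT F ->
  (\int[P]_x F x = \int[lebesgue_rV d]_x ((p x)%:E * F x))%E.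
Proof.
move=> Pp p0 mp F0 mF.
have D (nu : {measure set V -> \bar R}) (W : V -> R) :
    (\int[nu]_x ((W x)%:E * F x) = \int[nu]_x ((W x)%:E * \int[\d_x]_y F y))%E.
  by apply: eq_integral => x _; rewrite integral_dirac// diracT mul1e.
transitivity (\int[P]_x ((cst 1 x)%:E * F x))%E.
  by apply: eq_integral => x _; rewrite mul1e.
have mdirac B : measurable B -> measurable_fun setT (fun x : V => \d_x B : \bar R).
  by move=> mB; exact: (measurable_kernel (kdirac (@measurable_id _ V setT))).
rewrite !D; apply: eq_integral_mixture => // B mB.
under eq_integral do rewrite mul1e.
transitivity (P B); first by rewrite integral_indic// setIT.
rewrite Pp// [LHS]integral_mkcond.
by apply: eq_integral => x _; rewrite patchE /= /dirac indicE; case: ifPn => _;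
  rewrite ?mule1 ?mule0.
Qed.

End integral_density.

Section euclidean_norm.
Context {R : realType} {d : nat}.
Local Notation V := 'rV[R]_d.

Lemma dot_semi_inner_product :
  semi_inner_product (fun x y : V => \sum_i x 0 i * y 0 i).
Proof.
split=> [x y|x y z|a x y|x].
- by apply: eq_bigr => i _; rewrite mulrC.
- by rewrite -big_split/=; apply: eq_bigr => i _; rewrite mxE mulrDl.
- by rewrite mulr_sumr; apply: eq_bigr => i _; rewrite mxE mulrA.
- by apply: sumr_ge0 => i _; rewrite -expr2 sqr_ge0.
Qed.

Lemma enormE (x : V) : enorm x = sip_norm (fun x y : V => \sum_i x 0 i * y 0 i) x.
Proof. by congr Num.sqrt; apply: eq_bigr => i _; rewrite expr2. Qed.

Lemma enorm_ge0 (x : V) : 0 <= enorm x.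
Proof. exact: sqrtr_ge0. Qed.

Lemma enormD (x y : V) : enorm (x + y) <= enorm x + enorm y.
Proof. by rewrite !enormE; exact: (sip_normD dot_semi_inner_product). Qed.

Lemma enormZ a (x : V) : enorm (a *: x) = `|a| * enorm x.
Proof. by rewrite !enormE; exact: (sip_normZ dot_semi_inner_product). Qed.

Lemma abs_coord_le_enorm (x : V) i : `|x 0 i| <= enorm x.
Proof.
rewrite -sqrtr_sqr ler_wsqrtr// (bigD1 i)//= lerDl.
by apply: sumr_ge0 => j _; exact: sqr_ge0.
Qed.

Lemma measurable_enorm : measurable_fun setT (@enorm R d).
Proof.
have -> : @enorm R d = (fun x : V => (\sum_i x 0 i ^+ 2) `^ 2^-1).
  apply/funext => x; rewrite powR12_sqrt//.
  by apply: sumr_ge0 => i _; exact: sqr_ge0.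
apply: (measurableT_comp (measurable_powR _)).
by apply: measurable_sum => i; apply: measurable_funX; exact: measurable_rV_coord.
Qed.

Lemma measurable_powR_enorm (s : R) :
  measurable_fun setT (fun x : V => (1 + enorm x) `^ s).
Proof.
apply: (measurableT_comp (measurable_powR _)).
by apply: measurable_funD => //; exact: measurable_enorm.
Qed.

(** A form of Peetre's inequality: [1 + |x| <= (1 + |x + h u|) (1 + |u|)] when [h < 1], raised to
    the power [m] and inverted. *)
Lemma powR_enorm_le (x u : V) (h m : R) : 0 < h < 1 -> 0 <= m ->
  (1 + enorm (x + h *: u)) `^ (- m) <=
  (1 + enorm x) `^ (- m) * (1 + enorm u) `^ m.
Proof.
move=> /andP[h0 h1] m0.
have P (y : V) : 0 < 1 + enorm y by rewrite ltr_wpDr// enorm_ge0.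
rewrite !powRN mulrC ler_pdivlMr ?powR_gt0// mulrC ler_pdivrMr ?powR_gt0//.
rewrite -powRM ?(ltW (P _))//; apply: ge0_ler_powR; rewrite ?nnegrE ?mulr_ge0 ?(ltW (P _))//.
have := enormD (x + h *: u) (- h *: u).
rewrite scaleNr addrK -scaleNr enormZ normrN gtr0_norm//.
have u0 := enorm_ge0 u; have y0 := enorm_ge0 (x + h *: u).
have : h * enorm u <= enorm u by rewrite ler_piMl// ltW.
have := mulr_ge0 u0 y0; lra.
Qed.

End euclidean_norm.

(** * Integrability of negative powers of 1 + |x| *)

Section integrable_powR_enorm.
Context {R : realType}.

Let is_derive_powR1p (a y : R) : 0 <= y ->
  is_derive y 1 (fun y : R => (1 + y) `^ a) (a * (1 + y) `^ (a - 1)).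
Proof.
move=> y0; have y1 : 0 < 1 + y by lra.
have d1 : is_derive y 1 (fun y : R => 1 + y) (0 + 1) by exact: is_deriveD.
have dp := is_derive1_powR a y1.
have := is_derive1_comp dp d1.
by rewrite add0r mulr1.
Qed.

Let powR1p_cvg0 (t : R) : 1 < t -> (1 + y) `^ (1 - t) @[y --> +oo] --> 0.
Proof.
move=> t1; have t0 : 0 < t - 1 by lra.
have E (y : R) : (1 + y) `^ (1 - t) = ((1 + y) `^ (t - 1))^-1.
  by rewrite -powRN opprB.
under eq_fun do rewrite E.
apply/gtr0_cvgV0.
  by near=> y; rewrite powR_gt0// ltr_wpDr.
apply/cvgryPge => B; near=> y.
apply: (@le_trans _ _ (((`|B| + 1) `^ (t - 1)^-1) `^ (t - 1))).
  rewrite -powRrM mulVf ?gt_eqF// powRr1 ?addr_ge0//.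
  by have := ler_norm B; lra.
apply: ge0_ler_powR; rewrite ?nnegrE ?powR_ge0 ?(ltW t0)//.
  by rewrite addr_ge0.
have : (`|B| + 1) `^ (t - 1)^-1 <= y by near: y; exact: nbhs_pinfty_ge.
lra.
Unshelve. all: by end_near.
Qed.

Lemma integral_powR_half_line (t : R) : 1 < t ->
  (\int[@lebesgue_measure R]_(y in `[0%R, +oo[) ((1 + y) `^ (- t))%:E < +oo)%E.
Proof.
move=> t1.
pose F (y : R) := - (t - 1)^-1 * (1 + y) `^ (1 - t).
have dF (y : R) : 0 <= y -> is_derive y 1 F ((1 + y) `^ (- t)).
  move=> y0.
  have -> : (1 + y) `^ (- t) = - (t - 1)^-1 * ((1 - t) * (1 + y) `^ (1 - t - 1)).
    have -> : 1 - t - 1 = - t by lra.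
    by field; rewrite subr_eq0 gt_eqF.
  exact: (is_deriveZ _ (is_derive_powR1p (1 - t) y0)).
rewrite (@ge0_continuous_FTC2y R (fun y => (1 + y) `^ (- t)) F 0 0).
- by rewrite -EFinB ltry.
- by move=> x _; exact: powR_ge0.
- apply: derivable_within_continuous => y; rewrite in_itv/= andbT => y0.
  exact: (@ex_derive _ _ _ _ _ _ _ (is_derive_powR1p (- t) y0)).
- rewrite -(mulr0 (- (t - 1)^-1)); apply: cvgM; first exact: cvg_cst.
  exact: powR1p_cvg0.
- by move=> y /ltW /dF [].
- have [d0 _] := dF 0 (lexx _).
  exact/cvg_at_right_filter/differentiable_continuous/derivable1_diffP.
- move=> y; rewrite in_itv/= andbT => /ltW /dF dFy.
  by rewrite derive1E derive_val.
Qed.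

Lemma integral_powR_line (t : R) : 1 < t ->
  (\int[@lebesgue_measure R]_y ((1 + `|y|) `^ (- t))%:E < +oo)%E.
Proof.
move=> t1; pose f (y : R) := (1 + `|y|) `^ (- t).
have cf : continuous f.
  move=> y.
  apply: (@continuous_comp R R R (fun y : R => 1 + `|y|) (fun z : R => z `^ (- t))).
    by apply: cvgD; [exact: cvg_cst|exact: norm_continuous].
  have y1 : 0 < 1 + `|y| by rewrite ltr_wpDr.
  have [d1 _] := is_derive1_powR (- t) y1.
  exact/differentiable_continuous/derivable1_diffP.
rewrite (ge0_symfun_integralT (fun y => powR_ge0 (1 + `|y|) (- t)) cf); last first.
  by move=> y; rewrite /f /= normrN.
rewrite -set_itvcy; apply: lte_mul_pinfty => //.
apply: le_lt_trans (integral_powR_half_line t1); apply/eq_lee/eq_integral.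
by move=> y; rewrite inE/= in_itv/= andbT /f => y0; rewrite ger0_norm.
Qed.

Lemma integral_prod_powR_coord d (t : R) : 1 < t ->
  (\int[lebesgue_rV d]_x (\prod_(i < d) (1 + `|x 0 i|) `^ (- t))%:E < +oo)%E.
Proof.
move=> t1; have mw d' : measurable_fun setT
    (fun x : 'rV[R]_d' => (\prod_(i < d') (1 + `|x 0 i|) `^ (- t))%:E).
  apply/measurable_EFinP; apply: measurable_prod => i _.
  apply: (measurableT_comp (measurable_powR _)); apply: measurable_funD => //.
  by apply: measurableT_comp => //; exact: measurable_rV_coord.
have w0 d' (x : 'rV[R]_d') : (0 <= (\prod_(i < d') (1 + `|x 0 i|) `^ (- t))%:E)%E.
  by rewrite lee_fin; apply: prodr_ge0 => i _; exact: powR_ge0.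
have m1 : measurable_fun setT (fun y : R => ((1 + `|y|) `^ (- t))%:E).
  apply/measurable_EFinP; apply: (measurableT_comp (measurable_powR _)).
  by apply: measurable_funD => //; exact: measurableT_comp.
elim: d => [|d IH].
  have := integral_dirac (0 : 'rV[R]_0) measurableT (mw 0%N).
  by rewrite diracT mul1e => E; rewrite [X in (X < _)%E]E ltry.
rewrite ge0_integral_rVS//.
rewrite (eq_integral (fun y : measurableTypeR R => ((1 + `|y : R|) `^ (- t))%:E *
    \int[lebesgue_rV d]_x (\prod_(i < d) (1 + `|x 0 i|) `^ (- t))%:E)%E); last first.
  move=> y _; rewrite -ge0_integralZl//; last exact: mw.
  apply: eq_integral => w _; rewrite big_ord_recl mxE unlift_none EFinM.
  by congr (_ * _%:E)%E; apply: eq_bigr => i _; rewrite mxE liftK.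
have I0 : (0 <= \int[lebesgue_rV d]_x (\prod_(i < d) (1 + `|x 0 i|) `^ (- t))%:E)%E.
  exact: integral_ge0.
have E := ge0_integralZr lebesgue_measure measurableT m1
  (fun y _ => powR_ge0 (1 + `|y|) (- t) : (0 <= (_)%:E)%E) I0.
rewrite [X in (X < _)%E]E; apply: lte_mul_pinfty => //.
- by apply: integral_ge0 => y _; rewrite lee_fin powR_ge0.
- rewrite ge0_fin_numE; first exact: integral_powR_line.
  by apply: integral_ge0 => y _; rewrite lee_fin powR_ge0.
Qed.

(** Since each [|x_i|] is at most [|x|], the integrand is dominated by the product of the
    [(1 + |x_i|)^(-s/d)], whose exponent [s / d] exceeds 1. Tonelli then replaces polar
    coordinates. *)
Lemma integral_powR_enorm_lty d (s : R) : (0 < d)%N -> d%:R < s ->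
  (\int[lebesgue_rV d]_x ((1 + @enorm R d x) `^ (- s))%:E < +oo)%E.
Proof.
move=> d0 ds; have dR : 0 < d%:R :> R by rewrite ltr0n.
have t1 : 1 < s / d%:R by rewrite ltr_pdivlMr// mul1r.
apply: le_lt_trans (integral_prod_powR_coord d t1).
apply: ge0_le_integral => //.
- by move=> x _; rewrite lee_fin powR_ge0.
- by apply/measurable_EFinP; exact: measurable_powR_enorm.
- apply/measurable_EFinP; apply: measurable_prod => i _.
  apply: (measurableT_comp (measurable_powR _)); apply: measurable_funD => //.
  by apply: measurableT_comp => //; exact: measurable_rV_coord.
move=> x _; rewrite lee_fin.
have P (y : R) : 0 <= y -> 0 < 1 + y by move=> y0; rewrite ltr_wpDr.
have -> : (1 + enorm x) `^ (- s) = \prod_(i < d) (1 + enorm x) `^ (- (s / d%:R)).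
  rewrite prodr_const card_ord -powR_mulrn ?powR_ge0// -powRrM.
  by congr (_ `^ _); field; rewrite gt_eqF.
apply: ler_prod => i _; rewrite powR_ge0/= !powRN lef_pV2 ?posrE ?powR_gt0 ?P ?enorm_ge0//.
apply: ge0_ler_powR; last by rewrite lerD2l abs_coord_le_enorm.
- exact: ltW (lt_trans ltr01 t1).
- by rewrite nnegrE ltW// P.
- by rewrite nnegrE ltW// P// enorm_ge0.
Qed.

End integrable_powR_enorm.

(** * Kernel estimates *)

Lemma integral_abs_le_sqrt d (X : measurableType d) (R : realType)
    (Q : probability X R) (f : X -> R) (B : R) :
  measurable_fun setT f -> 0 <= B ->
  (\int[Q]_x (f x ^+ 2)%:E <= B%:E)%E -> (\int[Q]_x `|f x|%:E <= (Num.sqrt B)%:E)%E.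
Proof.
move=> mf B0 fB.
have mabs : measurable_fun setT (fun x => `|f x|) by exact: measurableT_comp.
have fL : (fun x => `|f x|) \in Lfun Q 2%:E.
  apply/Lfun2P; split => //; apply: le_lt_trans (ltry B); apply: le_trans fB.
  by apply/eq_lee/eq_integral => x _; rewrite real_normK ?num_real.
have Q1 : Q setT \is a fin_num by rewrite probability_setT.
have /Lfun1_integrable/integrable_fin_num fin := Lfun_subset12 Q1 fL.
rewrite -(fineK (fin _))// lee_fin.
have i0 : 0 <= \int[Q]_x `|f x| by apply: Rintegral_ge0.
rewrite -[leLHS](ger0_norm i0) -sqrtr_sqr ler_wsqrtr// -lee_fin.
apply: le_trans fB; apply: (le_trans (sqr_Rintegral_le (probability_setT Q) mabs)).
by apply/eq_lee/eq_integral => x _; rewrite real_normK ?num_real.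
Qed.

Section kernel.
Context {R : realType} {d : nat}.
Local Notation V := 'rV[R]_d.
Local Notation leb := (@lebesgue_rV R d).
Variables (K : V -> R) (h : R).
Hypotheses (mK : measurable_fun setT K) (K0 : forall u, 0 <= K u) (h0 : 0 < h).

Lemma measurable_scaled_kernel :
  measurable_fun setT (fun z : V * V => scaled_kernel K h z.1 z.2).
Proof.
apply: measurable_funM => //; apply: (measurableT_comp mK).
apply/measurable_fun_rVP => i; under eq_fun do rewrite !mxE.
apply: measurable_funM => //; apply: measurable_funB.
  exact: (measurableT_comp (measurable_rV_coord i) measurable_fst).
exact: (measurableT_comp (measurable_rV_coord i) measurable_snd).
Qed.

Lemma measurable_scaled_kernel_swap :
  measurable_fun setT (fun z : V * V => scaled_kernel K h z.2 z.1).
Proof.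
apply: (@measurableT_comp _ _ _ _ _ _ (fun z : V * V => scaled_kernel K h z.1 z.2)
  _ (fun z : V * V => (z.2, z.1))); first exact: measurable_scaled_kernel.
exact: measurable_swap.
Qed.

Lemma measurable_scaled_kernel1 x :
  measurable_fun setT (fun y => scaled_kernel K h y x).
Proof. exact: (measurableT_comp measurable_scaled_kernel (pair2_measurable x)). Qed.

Lemma scaled_kernel_ge0 y x : 0 <= scaled_kernel K h y x.
Proof. by rewrite mulr_ge0 ?K0// invr_ge0 exprn_ge0// ltW. Qed.

Let hd0 : h ^+ d != 0. Proof. by rewrite expf_neq0// gt_eqF. Qed.

(** The substitution [u = (y - x) / h] absorbs one of the two factors [h^-d]; the result does not
    depend on [y]. *)
Lemma integral_scaled_kernel_sqr y :
  (\int[leb]_x (scaled_kernel K h y x ^+ 2)%:E =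
   ((h ^+ d)^-1)%:E * \int[leb]_u (K u ^+ 2)%:E)%E.
Proof.
have mK2 : measurable_fun setT (fun u => (K u ^+ 2)%:E).
  by apply/measurable_EFinP/measurable_funX.
have c0 : - h^-1 != 0 by rewrite oppr_eq0 invr_neq0// gt_eqF.
have K20 (u : V) : (0 <= (K u ^+ 2)%:E)%E by rewrite lee_fin sqr_ge0.
rewrite (ge0_integral_affine_rV (h^-1 *: y) c0 K20 mK2).
rewrite muleA -EFinM normrN gtr0_norm ?invr_gt0// exprVn.
have mx : measurable_fun setT (fun x : V => (K (h^-1 *: y + - h^-1 *: x) ^+ 2)%:E).
  exact: (measurableT_comp mK2 (measurable_affine_rV _ _)).
rewrite -ge0_integralZl//; last first.
  by rewrite lee_fin !mulr_ge0 ?invr_ge0 ?exprn_ge0 ?ltW.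
apply: eq_integral => x _; rewrite -EFinM; congr _%:E.
by rewrite /scaled_kernel exprMn scalerBr scaleNr expr2.
Qed.

Section density.
Variables (P : probability V R) (p : V -> R) (Cp m : R).
Hypotheses (Pp : has_density P p) (p0 : forall x, 0 <= p x) (mp : measurable_fun setT p).
Hypotheses (Cp0 : 0 < Cp) (m0 : 0 <= m) (h1 : h < 1).
Hypothesis p_le : forall x, p x <= Cp * (1 + enorm x) `^ (- m).

(** After [y = x + h u], the decay of [p] at [x + h u] is split by [powR_enorm_le] into a weight in
    [x] and a weight in [u]. *)
Lemma integral_scaled_kernel_sqr_density_le x :
  (\int[P]_y (scaled_kernel K h y x ^+ 2)%:E <=
   ((h ^+ d)^-1 * (Cp * (1 + enorm x) `^ (- m)))%:E *
   \int[leb]_u ((1 + enorm u) `^ m * K u ^+ 2)%:E)%E.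
Proof.
have ms : measurable_fun setT (fun y => (scaled_kernel K h y x ^+ 2)%:E).
  by apply/measurable_EFinP; apply: measurable_funX; exact: measurable_scaled_kernel1.
have s0 y : (0 <= (scaled_kernel K h y x ^+ 2)%:E)%E by rewrite lee_fin sqr_ge0.
rewrite (ge0_integral_has_density Pp p0 mp s0 ms).
have h0' : h != 0 by rewrite gt_eqF.
rewrite (ge0_integral_affine_rV x h0'); last 2 first.
- by move=> y; apply: mule_ge0 => //; rewrite lee_fin.
- by apply: emeasurable_funM => //; exact/measurable_EFinP.
have mw : measurable_fun setT (fun u : V => ((1 + enorm u) `^ m * K u ^+ 2)%:E).
  apply/measurable_EFinP; apply: measurable_funM; first exact: measurable_powR_enorm.
  exact: measurable_funX.
have w0 (u : V) : (0 <= ((1 + enorm u) `^ m * K u ^+ 2)%:E)%E.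
  by rewrite lee_fin mulr_ge0 ?powR_ge0 ?sqr_ge0.
have hd : 0 < h ^+ d by exact: exprn_gt0.
have c0 : 0 <= (h ^+ d)^-1 * (Cp * (1 + enorm x) `^ (- m)).
  by rewrite !mulr_ge0 ?powR_ge0// ?invr_ge0 ltW.
have mxu : measurable_fun setT (fun u : V =>
    ((p (x + h *: u))%:E * (scaled_kernel K h (x + h *: u) x ^+ 2)%:E)%E).
  apply: (@measurableT_comp _ _ _ _ _ _
    (fun y => ((p y)%:E * (scaled_kernel K h y x ^+ 2)%:E)%E)).
    by apply: emeasurable_funM => //; exact/measurable_EFinP.
  exact: measurable_affine_rV.
rewrite -ge0_integralZl//; last first.
  by move=> u _; apply: mule_ge0 => //; rewrite lee_fin.
rewrite -[leRHS]ge0_integralZl//.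
apply: ge0_le_integral => //.
- move=> u _; apply: mule_ge0; first by rewrite lee_fin exprn_ge0.
  by apply: mule_ge0 => //; rewrite lee_fin.
- exact: measurable_funeM.
- exact: measurable_funeM.
move=> u _; rewrite -!EFinM lee_fin gtr0_norm//.
rewrite /scaled_kernel addrAC subrr add0r scalerA mulVf// scale1r exprMn.
set w := (1 + enorm x) `^ (- m); set v := (1 + enorm u) `^ m.
have -> : h ^+ d * (p (x + h *: u) * ((h ^+ d)^-1 ^+ 2 * K u ^+ 2)) =
    (h ^+ d)^-1 * (p (x + h *: u) * K u ^+ 2) by field.
have -> : (h ^+ d)^-1 * (Cp * w) * (v * K u ^+ 2) =
    (h ^+ d)^-1 * (Cp * (w * v) * K u ^+ 2) by ring.
rewrite ler_pM2l ?invr_gt0// ler_wpM2r ?sqr_ge0//.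
by rewrite (le_trans (p_le _))// ler_pM2l// powR_enorm_le// h0.
Qed.

End density.
End kernel.

(** The bound makes [E N] finite for large [N], where [fine] therefore loses nothing. *)
Lemma eqO_fine_le (R : realType) (E : nat -> \bar R) (g : R^nat) (k : R) :
  (\forall N \near \oo, (0 <= E N <= (k * g N)%:E)%E /\ 0 <= g N) ->
  (fun N => fine (E N)) =O_\oo g.
Proof.
move=> H; apply/eqO_exP; exists (`|k| + 1); first by rewrite ltr_wpDl.
apply: filterS H => N [/andP[E0 Ek] g0].
have Efin : E N \is a fin_num by rewrite ge0_fin_numE// (le_lt_trans Ek) ?ltry.
rewrite /= (ger0_norm g0) ger0_norm ?fine_ge0// -lee_fin fineK//.
rewrite (le_trans Ek)// lee_fin ler_wpM2r//.
by have := ler_norm k; lra.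
Qed.

Section estimator.
Context {R : realType} {d : nat} dO {Omega : measurableType dO}.
Variables (Pr : probability Omega R).
Local Notation V := 'rV[R]_d.
Local Notation leb := (@lebesgue_rV R d).
Variables (P : probability V R) (K : V -> R) (Z : nat -> {RV Pr >-> V}).
Hypotheses (mK : measurable_fun setT K) (K0 : forall u, 0 <= K u).

Section fixed_bandwidth.
Variables (h : R) (N : nat).
Hypothesis h0 : 0 < h.
Local Notation err := (estimation_error P K Z h N).

Lemma measurable_estimation_error :
  measurable_fun setT (fun z : V * Omega => err z.1 z.2).
Proof.
apply: measurable_funB.
  apply: measurable_funM => //; apply: measurable_sum => k.
  apply: (@measurableT_comp _ _ _ _ _ _ (fun z : V * V => scaled_kernel K h z.1 z.2)
    _ (fun z : V * Omega => (Z k z.2, z.1))).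
    exact: measurable_scaled_kernel.
  apply/measurable_fun_pairP; split.
    exact: (measurableT_comp (measurable_funPT (Z k)) measurable_snd).
  exact: measurable_fst.
apply: (@measurableT_comp _ _ _ _ _ _ (kernel_mean K h P)); last exact: measurable_fst.
apply: measurableT_comp => //.
apply: (measurable_fun_fubini_tonelli_F
  (fun z : V * V => (scaled_kernel K h z.2 z.1)%:E)).
- apply/measurable_EFinP; exact: measurable_scaled_kernel_swap.
- by move=> z; rewrite lee_fin; exact: scaled_kernel_ge0.
Qed.

Lemma measurable_estimation_error1 x : measurable_fun setT (err x).
Proof. exact: (measurableT_comp measurable_estimation_error (pair1_measurable x)). Qed.

Lemma L2_errorE :
  L2_error P K Z h N = (\int[leb]_x \int[Pr]_w (err x w ^+ 2)%:E)%E.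
Proof. by apply: eq_integral => x _; rewrite unlock. Qed.

Lemma L1_errorE :
  L1_error P K Z h N = (\int[leb]_x \int[Pr]_w `|err x w|%:E)%E.
Proof. by apply: eq_integral => x _; rewrite unlock. Qed.

Lemma L2_error_ge0 : (0 <= L2_error P K Z h N)%E.
Proof.
rewrite L2_errorE; apply: integral_ge0 => x _; apply: integral_ge0 => w _.
by rewrite lee_fin sqr_ge0.
Qed.

Lemma L1_error_ge0 : (0 <= L1_error P K Z h N)%E.
Proof.
by rewrite L1_errorE; apply: integral_ge0 => x _; apply: integral_ge0 => w _.
Qed.

Variable C : R.
Hypotheses (C0 : 0 < C) (N0 : (0 < N)%N).
Hypothesis mse : forall f : V -> R, measurable_fun setT f ->
  (\int[Pr]_w ((N%:R^-1 * (\sum_(k < N) f (Z k w)) - \int[P]_x f x) ^+ 2)%:E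
    <= (C / N%:R)%:E * \int[P]_x (f x ^+ 2)%:E)%E.

(** At fixed [x] the estimator is the sample mean of [K_h (_, x)]. *)
Let err_sqr_le x : (\int[Pr]_w (err x w ^+ 2)%:E <=
  (C / N%:R)%:E * \int[P]_y (scaled_kernel K h y x ^+ 2)%:E)%E.
Proof. exact: (mse (measurable_scaled_kernel1 h mK x)). Qed.

Let CN0 : 0 <= C / N%:R. Proof. by rewrite divr_ge0// ltW. Qed.

Lemma L2_error_le : (L2_error P K Z h N <=
  (C / (N%:R * h ^+ d))%:E * \int[leb]_u (K u ^+ 2)%:E)%E.
Proof.
have ms : measurable_fun setT (fun z : V * V => (scaled_kernel K h z.2 z.1 ^+ 2)%:E).
  apply/measurable_EFinP; apply: measurable_funX.
  exact: measurable_scaled_kernel_swap.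
have s0 (z : V * V) : (0 <= (scaled_kernel K h z.2 z.1 ^+ 2)%:E)%E.
  by rewrite lee_fin sqr_ge0.
have mi : measurable_fun setT (fun x => \int[P]_y (scaled_kernel K h y x ^+ 2)%:E)%E.
  exact: (measurable_fun_fubini_tonelli_F _ ms s0).
have i0 x : (0 <= \int[P]_y (scaled_kernel K h y x ^+ 2)%:E)%E.
  by apply: integral_ge0 => y _; rewrite lee_fin sqr_ge0.
rewrite L2_errorE.
apply: (@le_trans _ _ (\int[leb]_x ((C / N%:R)%:E *
    \int[P]_y (scaled_kernel K h y x ^+ 2)%:E))%E).
  apply: ge0_le_integral => //.
  - by move=> x _; apply: integral_ge0 => w _; rewrite lee_fin sqr_ge0.
  - apply: (measurable_fun_fubini_tonelli_F (fun z : V * Omega => (err z.1 z.2 ^+ 2)%:E)).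
      apply/measurable_EFinP; apply: measurable_funX; exact: measurable_estimation_error.
    by move=> z; rewrite lee_fin sqr_ge0.
  - exact: measurable_funeM.
rewrite ge0_integralZl//.
(* Integrating in [x] first gives a quantity independent of [y], so [P] contributes only its total
   mass 1. *)
rewrite (fubini_tonelli (fun z : V * V => (scaled_kernel K h z.2 z.1 ^+ 2)%:E) ms s0)/=.
under eq_integral do rewrite integral_scaled_kernel_sqr//.
rewrite integral_cst//.
rewrite [X in (_ * (_ * X))%E](_ : _ = 1%E); last exact: probability_setT.
apply/eq_lee.
rewrite mule1 muleA -EFinM; congr (_%:E * _)%E.
have hd : h ^+ d != 0 by rewrite expf_neq0// gt_eqF.
have NR : N%:R != 0 :> R by rewrite pnatr_eq0 -lt0n.
by field; rewrite ?hd ?NR.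
Qed.

Section density.
Variables (p : V -> R) (Cp m : R).
Hypotheses (Pp : has_density P p) (p0 : forall x, 0 <= p x) (mp : measurable_fun setT p).
Hypotheses (Cp0 : 0 < Cp) (m0 : 0 <= m) (h1 : h < 1).
Hypothesis p_le : forall x, p x <= Cp * (1 + enorm x) `^ (- m).
Let M := (\int[leb]_u ((1 + enorm u) `^ m * K u ^+ 2)%:E)%E.
Hypothesis Moo : (M < +oo)%E.

Lemma L1_error_le : (L1_error P K Z h N <=
  (Num.sqrt (C * Cp * fine M))%:E *
  \int[leb]_x ((1 + enorm x) `^ (- m / 2))%:E *
  ((Num.sqrt N%:R * h `^ (d%:R / 2))^-1)%:E)%E.
Proof.
have M0 : (0 <= M)%E.
  by apply: integral_ge0 => u _; rewrite lee_fin mulr_ge0 ?powR_ge0 ?sqr_ge0.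
have MR : M = (fine M)%:E by rewrite fineK// ge0_fin_numE.
have fM0 : 0 <= fine M by rewrite fine_ge0.
pose B (x : V) := C / N%:R * ((h ^+ d)^-1 * (Cp * (1 + enorm x) `^ (- m)) * fine M).
have B0 x : 0 <= B x.
  by rewrite /B !mulr_ge0 ?powR_ge0 ?invr_ge0 ?exprn_ge0// ltW.
have errB x : (\int[Pr]_w (err x w ^+ 2)%:E <= (B x)%:E)%E.
  apply: (le_trans (err_sqr_le x)); rewrite /B [leRHS]EFinM lee_wpmul2l ?lee_fin//.
  rewrite [leRHS]EFinM -MR.
  by apply: (integral_scaled_kernel_sqr_density_le mK h0 Pp p0 mp).
have errA x := integral_abs_le_sqrt (measurable_estimation_error1 x) (B0 x) (errB x).
have NR : 0 < N%:R :> R by rewrite ltr0n.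
(* The square root of [B] separates the constant, the rate in [N] and [h], and the weight in [x]. *)
have sB x : Num.sqrt (B x) = Num.sqrt (C * Cp * fine M) *
    (Num.sqrt N%:R * h `^ (d%:R / 2))^-1 * (1 + enorm x) `^ (- m / 2).
  have x1 : 0 <= 1 + enorm x by rewrite addr_ge0 ?enorm_ge0.
  have -> : B x = (C * Cp * fine M) * ((N%:R * h ^+ d)^-1 * (1 + enorm x) `^ (- m)).
    have hd : h ^+ d != 0 by rewrite expf_neq0// gt_eqF.
    have N1 : N%:R != 0 :> R by rewrite gt_eqF.
    by rewrite /B; field; rewrite ?hd ?N1.
  rewrite sqrtrM; last by rewrite !mulr_ge0// ltW.
  rewrite [Num.sqrt (_^-1 * _)]sqrtrM; last by rewrite invr_ge0 mulr_ge0 ?exprn_ge0 ?ltW.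
  rewrite sqrtrV; last by rewrite mulr_ge0 ?exprn_ge0 ?ltW.
  rewrite [Num.sqrt (N%:R * _)]sqrtrM ?ler0n// mulrA.
  congr (_ * (_ * _)^-1 * _).
    by rewrite -powR12_sqrt ?exprn_ge0 ?ltW// -powR_mulrn ?ltW// -powRrM.
  by rewrite -powR12_sqrt ?powR_ge0// -powRrM.
rewrite L1_errorE.
have mw : measurable_fun setT (fun x : V => ((1 + enorm x) `^ (- m / 2))%:E).
  by apply/measurable_EFinP; exact: measurable_powR_enorm.
rewrite muleAC -EFinM -ge0_integralZl//; last 2 first.
- by move=> x _; rewrite lee_fin powR_ge0.
- by rewrite lee_fin !mulr_ge0 ?invr_ge0 ?mulr_ge0 ?sqrtr_ge0 ?powR_ge0.
apply: ge0_le_integral => //.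
- by move=> x _; apply: integral_ge0.
- apply: (measurable_fun_fubini_tonelli_F (fun z : V * Omega => `|err z.1 z.2|%:E)) => //.
  apply/measurable_EFinP; apply: measurableT_comp => //; exact: measurable_estimation_error.
- exact: measurable_funeM.
- by move=> x _; rewrite -EFinM -sB; exact: errA.
Qed.

End density.
End fixed_bandwidth.
End estimator.

(** * Integrated error bounds and their rates along a bandwidth sequence *)

Theorem theorem5p5 (R : realType) (d : nat) (d_gt0 : (0 < d)%N)
  (P : probability 'rV[R]_d R) (p K : 'rV[R]_d -> R)
  (p_gt0 : forall x, 0 < p x)
  (P_p : has_density P p)
  (K_kernel : smoothing_kernel K)
  (p_sobolev : sobolev 2 1%E p /\ sobolev 2 2%:E p)
  (dO : measure_display) (Omega : measurableType dO) (Pr : probability Omega R)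
  (Z : nat -> {RV Pr >-> 'rV[R]_d})
  (Z_samples : iid P Z \/
     exists2 T : R.-pker 'rV[R]_d ~> 'rV[R]_d,
       stationary_markov_chain P T Z &
       has_spectral_gap P T \/ has_pseudo_spectral_gap P T) :
  exists2 C_mc : R, 0 < C_mc &
  forall h : R^nat, bandwidth d h ->
    [/\ forall N, (0 < N)%N ->
          (L2_error P K Z (h N) N <=
           (C_mc / (N%:R * h N ^+ d))%:E *
           'N[lebesgue_rV d]_2%:E[EFin \o K] ^+ 2)%E,
        (fun N => fine (L2_error P K Z (h N) N))
          =O_\oo (fun N => (N%:R * h N ^+ d)^-1) &
        forall C_p m : R, 0 < C_p -> 2 * d%:R < m ->
          let M := (\int[lebesgue_rV d]_u
                      ((1 + enorm u) `^ m * K u ^+ 2)%:E)%E in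
          (M < +oo)%E ->
          (forall x, p x <= C_p * (1 + enorm x) `^ (- m)) ->
          let C_1 := ((Num.sqrt (C_mc * C_p * fine M))%:E *
            \int[lebesgue_rV d]_x ((1 + enorm x) `^ (- m / 2))%:E)%E in
          [/\ (C_1 < +oo)%E,
              forall N, (0 < N)%N -> h N < 1 ->
                (L1_error P K Z (h N) N <=
                 C_1 * ((Num.sqrt N%:R * h N `^ (d%:R / 2))^-1)%:E)%E &
              (fun N => fine (L1_error P K Z (h N) N))
                =O_\oo (fun N => (Num.sqrt N%:R * h N `^ (d%:R / 2))^-1)]].
Proof.
have [K0 [K1 K2] _ _ _] := K_kernel.
have mK := Lfun2_measurable K2.
have p1 : p \in Lfun (lebesgue_rV d) 2%:E by case: p_sobolev => _ [].
have mp := Lfun2_measurable p1.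
have p0 x : 0 <= p x by exact: ltW.
have [C C0 mse] := sample_mean_square_error Z_samples.
(* [C] comes from the samples alone and is fixed before the bandwidth. *)
exists C => // h [h0 hto0 _].
have normK : ('N[lebesgue_rV d]_2%:E[EFin \o K] ^+ 2 =
    \int[lebesgue_rV d]_u (K u ^+ 2)%:E)%E.
  have -> : (\int[lebesgue_rV d]_u (K u ^+ 2)%:E =
      (\int[lebesgue_rV d]_u (K u * K u))%:E)%E.
    rewrite fineK; last exact/integrable_fin_num/(Lfun2_mulr_integrable K2 K2).
    by apply: eq_integral => u _; rewrite expr2.
  rewrite Lnorm2E// -EFin_expe sqr_sqrtr//.
  by apply: Rintegral_ge0 => u _; rewrite -expr2 sqr_ge0.
have L2le N : (0 < N)%N -> (L2_error P K Z (h N) N <=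
    (C / (N%:R * h N ^+ d))%:E * 'N[lebesgue_rV d]_2%:E[EFin \o K] ^+ 2)%E.
  move=> N0; rewrite normK.
  by apply: L2_error_le => //; [exact: h0|move=> f mf; exact: mse].
have N_pos : \forall N \near \oo, (0 < N)%N by exact: nbhs_infty_gt.
split=> //.
  have /Lfun2P[_ K2oo] := K2.
  have K2fin : (\int[lebesgue_rV d]_u (K u ^+ 2)%:E)%E \is a fin_num.
    rewrite ge0_fin_numE//; apply: integral_ge0 => u _.
    by rewrite lee_fin sqr_ge0.
  apply: (@eqO_fine_le _ _ _
    (C * fine (\int[lebesgue_rV d]_u (K u ^+ 2)%:E))).
  apply: filterS N_pos => N N0; split.
    rewrite L2_error_ge0 (le_trans (L2le N N0))// normK -(fineK K2fin) -EFinM.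
    by rewrite lee_fin mulrAC.
  by rewrite invr_ge0 mulr_ge0// exprn_ge0// ltW// h0.
move=> C_p m Cp0 dm M Moo p_le C_1.
have m0 : 0 <= m by rewrite (le_trans _ (ltW dm))// mulr_ge0.
have M0 : (0 <= M)%E.
  by apply: integral_ge0 => u _; rewrite lee_fin mulr_ge0 ?powR_ge0 ?sqr_ge0.
have I0 : (0 <= \int[lebesgue_rV d]_x ((1 + @enorm R d x) `^ (- m / 2))%:E)%E.
  by apply: integral_ge0 => x _; rewrite lee_fin powR_ge0.
have Ioo : (\int[lebesgue_rV d]_x ((1 + @enorm R d x) `^ (- m / 2))%:E < +oo)%E.
  (* The assumption [2 d < m] says that the exponent [m / 2] exceeds [d]. *)
  rewrite mulNr; apply: integral_powR_enorm_lty => //.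
  by rewrite ltr_pdivlMr// mulrC.
have C1oo : (C_1 < +oo)%E.
  by apply: lte_mul_pinfty => //; rewrite ?lee_fin ?sqrtr_ge0.
have C10 : (0 <= C_1)%E by apply: mule_ge0 => //; rewrite lee_fin sqrtr_ge0.
have L1le N : (0 < N)%N -> h N < 1 -> (L1_error P K Z (h N) N <=
    C_1 * ((Num.sqrt N%:R * h N `^ (d%:R / 2))^-1)%:E)%E.
  move=> N0 h1; apply: (L1_error_le mK K0 (h0 N N0) C0 N0 _ P_p) => //.
  by move=> f mf; exact: mse.
split=> //.
apply: (@eqO_fine_le _ _ _ (fine C_1)).
have h_lt1 : \forall N \near \oo, h N < 1 by apply: (cvgr_lt _ hto0).
apply: filterS2 N_pos h_lt1 => N N0 h1; split.
  by rewrite L1_error_ge0 EFinM fineK ?ge0_fin_numE// L1le.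
by rewrite invr_ge0 mulr_ge0 ?sqrtr_ge0 ?powR_ge0.
Qed.
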